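(* Let $R$ be a principal ideal domain and $\overline t'$ the perversity defined by $\overline t'(i)=i-2$ for $i\ne0$ (and $\overline t'(0)=0$). For any normal filtered face set $K$ there are isomorphisms $$H^*_{\mathrm{TW},\overline 0}(K;R)\cong H^*_{\mathrm{GM},\overline t'}(K;R)\cong H^*(K;R),$$ where the last term is the ordinary cohomology of the face set underlying $K$.
   Context: Fix an integer $n\ge 0$. Let $\mathbf\Delta^{[n]}_{\mathcal F}$ be the category whose objects are the joins $\Delta=\Delta^{j_0}*\cdots*\Delta^{j_n}$ with $j_i\ge -1$ (conventions $\Delta^{-1}=\emptyset$, $\emptyset*X=X$; not all factors empty) and whose morphisms are joins $*_i\sigma_i$ where each $\sigma_i\colon\Delta^{j_i}\to\Delta^{k_i}$ is induced by an injective order-preserving map of vertices, or is $\emptyset\to\Delta^{k_i}$. A filtered face set is a contravariant functor $K$ from $\mathbf\Delta^{[n]}_{\mathcal F}$ to sets; its elements are simplices $\sigma\colon\Delta^{j_0}*\cdots*\Delta^{j_n}\to K$. $K_+$ denotes the simplices with $j_n\ge 0$. Forgetting the join decompositions gives the underlying face set (simplicial set without degeneracies). Write $\sigma\vartriangleleft\phi$ if $\sigma$ is a face (of any codimension) of $\phi$. $K$ is normal if (a) every $\sigma\in K\setminus K_+$ is a face of some $\phi\in K_+$; (b) for every $\sigma\in K\setminus K_+$ and $\phi,\phi'\in K_+$ with $\sigma\vartriangleleft\phi$ and $\sigma\vartriangleleft\phi'$, there are $\phi_1,\dots,\phi_m\in K_+$ with $\sigma\vartriangleleft\phi_i$ for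 all $i$ and $\phi\vartriangleleft\phi_1\vartriangleright\cdots\vartriangleleft\phi_m\vartriangleright\phi'$. GM-cohomology: $C_*^{\mathrm{GM}}(K;R)$ is the free $R$-module on the simplices of $K$ with the usual boundary. For $\sigma\colon\Delta=\Delta^{j_0}*\cdots*\Delta^{j_n}\to K$ put $\|\sigma\|_\ell=\dim(\Delta^{j_0}*\cdots*\Delta^{j_{n-\ell}})$ ($-\infty$ if empty). $\sigma$ is $\overline p$-admissible if $\|\sigma\|_\ell\le\dim\Delta-\ell+\overline p(\ell)$ for $\ell\in\{1,\dots,n\}$; a chain is $\overline p$-admissible if it is a linear combination of $\overline p$-admissible simplices. $C_*^{\mathrm{GM},\overline p}(K;R)$ is the complex of chains $c$ with $c$ and $\partial c$ $\overline p$-admissible, and $H^*_{\mathrm{GM},\overline p}(K;R)$ is the cohomology of $\mathrm{Hom}(C_*^{\mathrm{GM},\overline p}(K;R),R)$. TW-cohomology: let $C^*(\Delta^m;R)$ be simplicial cochains. Write $c\Delta^j=\Delta^{j+1}$ for the cone on $\Delta^j$, with cone point the last vertex ($c\emptyset=\Delta^0$), and $\Delta^j\times\{1\}$ for its face opposite to the cone point. $\widetilde C^*(K;R)$ is the cochain complex of families $\omega=(\omega_\sigma)_{\sigma\in K_+}$, $\omega_\sigma\in C^*(c\Delta^{j_0})\otimes\cdots\otimes C^*(c\Delta^{j_{n-1}})\otimes C^*(\Delta^{j_n})$, with $\omega_{\sigma\circ\delta}=\delta^*\omega_\sigma$ for every morphism $\delta$ between objects with non-empty last factor. For $\ell\in\{1,\dots,n\}$: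 $\|\omega_\sigma\|_\ell=-\infty$ if $j_{n-\ell}=-1$; otherwise restrict the factor of index $n-\ell$ to $C^*(\Delta^{j_{n-\ell}}\times\{1\})$ and let $\|\omega_\sigma\|_\ell$ be the largest $d$ such that the component of the restriction of total degree $d$ in the last $\ell$ tensor factors is non-zero ($-\infty$ if the restriction is zero). $\|\omega\|_\ell=\sup_\sigma\|\omega_\sigma\|_\ell$. $\widetilde C^*_{\overline q}(K;R)$ is the subcomplex of $\omega$ with $\|\omega\|_\ell,\|d\omega\|_\ell\le\overline q(\ell)$ for all $\ell$, and $H^*_{\mathrm{TW},\overline q}(K;R)$ its cohomology; $\overline 0$ is the zero perversity.
   Formalization: In condition (b) of normality the face relations carry chosen inclusions of σ and the zigzag must respect them; with the bare relation the claim fails, e.g. for Δ^1*Δ^0 with the two vertices of Δ^1 identified, where H^1(K;R)=R but the GM-cohomology in degree 1 is 0. *)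

(* Defs.v *)
From HB Require Import structures.
From mathcomp Require Import all_boot all_order all_algebra.
From mathcomp Require Import boolp.
From mathcomp Require Import constructive_ereal prodnormedzmodule.
From mathcomp Require Import freeg generic_quotient ring_quotient.
From mathcomp Require Import ring zify.

Set Implicit Arguments.
Unset Strict Implicit.
Unset Printing Implicit Defensive.

Import Order.TTheory GRing.Theory Num.Theory.
Local Open Scope ring_scope.
Local Open Scope quotient_scope.

Section Submodule.
Variables (R : pzRingType) (V : lmodType R).

Record submodule := Submodule {
  submodule_pred :> {pred V};
  submodule_closed : submod_closed submodule_pred }.

Variable S : submodule.
Definition spred : {pred V} := submodule_pred S.
HB.instance Definition _ := GRing.isSubmodClosed.Build R V spred (submodule_closed S).

Record submod := Submod { submod_val :> V; submodP : submod_val \in spred }.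
HB.instance Definition _ := [isSub for submod_val].
HB.instance Definition _ := [Choice of submod by <:].
HB.instance Definition _ := [SubChoice_isSubLmodule of submod by <:].

Definition quotmod : Type := {ideal_quot spred}.
HB.instance Definition _ := GRing.Zmodule.on quotmod.

Definition quotmod_pi (x : V) : quotmod := \pi_{ideal_quot spred} x.
Definition quotmod_repr (x : quotmod) : V := repr (x : {ideal_quot spred}).

Lemma quotmod_reprK x : quotmod_pi (quotmod_repr x) = x.
Proof. exact: reprK. Qed.

Lemma quotmod_eq x y : (quotmod_pi x == quotmod_pi y) = (x - y \in S).
Proof. by rewrite -Quotient.idealrBE. Qed.

Lemma quotmod_piD x y : quotmod_pi (x + y) = quotmod_pi x + quotmod_pi y.
Proof. exact: (Quotient.pi_add spred). Qed.

Definition quotmod_scale (a : R) (x : quotmod) : quotmod :=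
  quotmod_pi (a *: quotmod_repr x).

Lemma quotmod_piZ a x : quotmod_pi (a *: x) = quotmod_scale a (quotmod_pi x).
Proof.
apply/eqP; rewrite quotmod_eq -scalerBr; apply: (@rpredZ R V spred).
by rewrite -[_ \in _]quotmod_eq quotmod_reprK.
Qed.

Lemma quotmod_scaleA a b x :
  quotmod_scale a (quotmod_scale b x) = quotmod_scale (a * b) x.
Proof. by rewrite -[x]quotmod_reprK -!quotmod_piZ scalerA. Qed.

Lemma quotmod_scale1 x : quotmod_scale 1 x = x.
Proof. by rewrite -[x]quotmod_reprK -!quotmod_piZ scale1r. Qed.

Lemma quotmod_scaleDr : right_distributive quotmod_scale +%R.
Proof.
move=> a x y; rewrite -[x]quotmod_reprK -[y]quotmod_reprK.
by rewrite -quotmod_piD -!quotmod_piZ -quotmod_piD scalerDr.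
Qed.

Lemma quotmod_scaleDl x : {morph quotmod_scale^~ x : a b / a + b}.
Proof.
by move=> a b; rewrite -[x]quotmod_reprK -!quotmod_piZ -quotmod_piD scalerDl.
Qed.

HB.instance Definition _ := GRing.Zmodule_isLmodule.Build R quotmod
  quotmod_scaleA quotmod_scale1 quotmod_scaleDr quotmod_scaleDl.

Lemma quotmod_pi_linear : linear quotmod_pi.
Proof. by move=> a x y; rewrite quotmod_piD quotmod_piZ. Qed.

End Submodule.

Section LinearModule.
Variables (R : comNzRingType) (U V : lmodType R).
Local Notation hom := {linear U -> V}.
Implicit Types f g h : hom.

Lemma hom_eqP f g : f =1 g -> f = g.
Proof.
move=> e; have {e} : (f : U -> V) = g by apply/funext.
case: f g => [f [[fa] [fb]]] [g [[ga] [gb]]] /= E; subst g.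
by rewrite (Prop_irrelevance fa ga) (Prop_irrelevance fb gb).
Qed.

Definition hom_zero : hom := \0.
Definition hom_opp f : hom := \- f.
Definition hom_add f g : hom := f \+ g.
Definition hom_scale (a : R) f : hom := a \*: f.

Lemma hom_addA : associative hom_add.
Proof. by move=> f g h; apply: hom_eqP => x /=; rewrite addrA. Qed.
Lemma hom_addC : commutative hom_add.
Proof. by move=> f g; apply: hom_eqP => x /=; rewrite addrC. Qed.
Lemma hom_add0 : left_id hom_zero hom_add.
Proof. by move=> f; apply: hom_eqP => x /=; rewrite add0r. Qed.
Lemma hom_addN : left_inverse hom_zero hom_opp hom_add.
Proof. by move=> f; apply: hom_eqP => x /=; rewrite addNr. Qed.

HB.instance Definition _ :=
  GRing.isZmodule.Build hom hom_addA hom_addC hom_add0 hom_addN.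

Lemma hom_scaleA a b f : hom_scale a (hom_scale b f) = hom_scale (a * b) f.
Proof. by apply: hom_eqP => x /=; rewrite scalerA. Qed.
Lemma hom_scale1 : left_id 1 hom_scale.
Proof. by move=> f; apply: hom_eqP => x /=; rewrite scale1r. Qed.
Lemma hom_scaleDr : right_distributive hom_scale +%R.
Proof. by move=> a f g; apply: hom_eqP => x /=; rewrite scalerDr. Qed.
Lemma hom_scaleDl f : {morph hom_scale^~ f : a b / a + b}.
Proof. by move=> a b; apply: hom_eqP => x /=; rewrite scalerDl. Qed.

HB.instance Definition _ := GRing.Zmodule_isLmodule.Build R hom
  hom_scaleA hom_scale1 hom_scaleDr hom_scaleDl.

Lemma hom_addE f g x : (f + g) x = f x + g x. Proof. by []. Qed.
Lemma hom_scaleE a f x : (a *: f) x = a *: f x. Proof. by []. Qed.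

End LinearModule.

Section DependentFamilies.
Variables (R : pzRingType) (I : Type) (V : I -> lmodType R).

Definition family_mod := forall i, V i.
Implicit Types x y z : family_mod.

HB.instance Definition _ := Choice.copy family_mod (forall i, V i).

Definition family_zero : family_mod := fun i => 0.
Definition family_opp x : family_mod := fun i => - x i.
Definition family_add x y : family_mod := fun i => x i + y i.
Definition family_scale (a : R) x : family_mod := fun i => a *: x i.

Lemma family_addA : associative family_add.
Proof. by move=> x y z; apply: functional_extensionality_dep => i; exact: addrA. Qed.
Lemma family_addC : commutative family_add.
Proof. by move=> x y; apply: functional_extensionality_dep => i; exact: addrC. Qed.
Lemma family_add0 : left_id family_zero family_add.
Proof. by move=> x; apply: functional_extensionality_dep => i; exact: add0r. Qed.
Lemma family_addN : left_inverse family_zero family_opp family_add.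
Proof. by move=> x; apply: functional_extensionality_dep => i; exact: addNr. Qed.

HB.instance Definition _ := GRing.isZmodule.Build family_mod
  family_addA family_addC family_add0 family_addN.

Lemma family_scaleA a b x :
  family_scale a (family_scale b x) = family_scale (a * b) x.
Proof. by apply: functional_extensionality_dep => i; exact: scalerA. Qed.
Lemma family_scale1 : left_id 1 family_scale.
Proof. by move=> x; apply: functional_extensionality_dep => i; exact: scale1r. Qed.
Lemma family_scaleDr : right_distributive family_scale +%R.
Proof. by move=> a x y; apply: functional_extensionality_dep => i; exact: scalerDr. Qed.
Lemma family_scaleDl x : {morph family_scale^~ x : a b / a + b}.
Proof. by move=> a b; apply: functional_extensionality_dep => i; exact: scalerDl. Qed.

HB.instance Definition _ := GRing.Zmodule_isLmodule.Build R family_mod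
  family_scaleA family_scale1 family_scaleDr family_scaleDl.

Lemma family_linE a x y i : (a *: x + y) i = a *: x i + y i.
Proof. by []. Qed.

End DependentFamilies.

Definition principal_ideal_domain (R : idomainType) : Prop :=
  forall I : {pred R^o}, submod_closed I ->
  exists a : R, forall x : R, x \in I <-> exists r : R, x = r * a.

Definition lmod_iso (R : pzRingType) (U V : lmodType R) : Prop :=
  exists f : {linear U -> V}, bijective f.

Record cochain_complex (R : pzRingType) := CochainComplex {
  cochain :> nat -> lmodType R;
  coboundary : forall k, {linear cochain k -> cochain k.+1};
  coboundary2 : forall k x, coboundary k.+1 (coboundary k x) = 0 }.

Record chain_complex (R : pzRingType) := ChainComplex {
  chain :> nat -> lmodType R;
  boundary : forall k, {linear chain k.+1 -> chain k};
  boundary2 : forall k x, boundary k (boundary k.+1 x) = 0 }.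

Section Cohomology.
Variables (R : pzRingType) (C : cochain_complex R) (k : nat).

Lemma cocycle_closed : submod_closed (fun x : C k => coboundary C k x == 0).
Proof.
split=> [|a x y]; first by rewrite unfold_in linear0.
by rewrite !unfold_in linearP => /eqP-> /eqP->; rewrite scaler0 addr0.
Qed.

Definition cocycle := submod (Submodule cocycle_closed).

Definition is_coboundary : C k -> Prop :=
  match k return C k -> Prop with
  | 0 => fun x => x = 0
  | k'.+1 => fun x => exists y : C k', x = coboundary C k' y
  end.

Lemma is_coboundary0 : is_coboundary 0.
Proof. by rewrite /is_coboundary; case: k => // k'; exists 0; rewrite linear0. Qed.

Lemma is_coboundaryP a x y :
  is_coboundary x -> is_coboundary y -> is_coboundary (a *: x + y).
Proof.
rewrite /is_coboundary; case: k x y => [x y -> ->|k' _ _ [u ->] [v ->]].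
  by rewrite scaler0 addr0.
by exists (a *: u + v); rewrite linearP.
Qed.

Lemma coboundary_closed :
  submod_closed (fun z : cocycle => `[< is_coboundary (val z) >]).
Proof.
split=> [|a x y]; rewrite !unfold_in; first exact/asboolP/is_coboundary0.
by move=> /asboolP hx /asboolP hy; apply/asboolP/is_coboundaryP.
Qed.

Definition cohomology : lmodType R := quotmod (Submodule coboundary_closed).

End Cohomology.

Section Dual.
Variables (R : comNzRingType) (C : chain_complex R).

Definition dual_d k (f : {linear C k -> R^o}) : {linear C k.+1 -> R^o} :=
  f \o boundary C k.

Lemma dual_d_linear k : linear (@dual_d k).
Proof. by move=> a f g; apply: hom_eqP. Qed.
HB.instance Definition _ k := GRing.isLinear.Build R _ _ _ (@dual_d k) (@dual_d_linear k).

Lemma dual_d2 k (f : {linear C k -> R^o}) : dual_d (dual_d f) = 0.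
Proof. by apply: hom_eqP => x /=; rewrite boundary2 linear0. Qed.

Definition dual_complex : cochain_complex R :=
  @CochainComplex R (fun k => {linear C k -> R^o}) (fun k => @dual_d k) dual_d2.

End Dual.

Section Joins.
Variable n : nat.

(* The join Delta^{j_0} * ... * Delta^{j_n}; nverts i is j_i + 1, so that an
   empty factor has value 0. *)
Record join_shape := JoinShape {
  nverts :> {ffun 'I_n.+1 -> nat};
  nverts_gt0 : (0 < \sum_i nverts i)%N }.

HB.instance Definition _ := [isSub for nverts].
HB.instance Definition _ := [Choice of join_shape by <:].

Definition nvert (a : join_shape) : nat := (\sum_i a i)%N.
Definition join_dim (a : join_shape) : nat := (nvert a).-1.

Definition regular (a : join_shape) : bool := (0 < a ord_max)%N.

(* When a i = 0 the i-th component is the unique map from the empty simplex. *)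
Record join_mor (a b : join_shape) := JoinMor {
  join_fun :> forall i, 'I_(a i) -> 'I_(b i);
  join_funP : forall i (x y : 'I_(a i)), (x < y)%N -> (join_fun x < join_fun y)%N }.

Definition join_id (a : join_shape) : join_mor a a :=
  @JoinMor a a (fun i x => x) (fun i x y xy => xy).

Definition join_comp (a b c : join_shape) (g : join_mor b c) (f : join_mor a b) :
  join_mor a c :=
  @JoinMor a c (fun i x => g i (f i x)) (fun i x y xy => join_funP g (join_funP f xy)).

Lemma join_mor_eqP a b (f g : join_mor a b) : (forall i, f i =1 g i) -> f = g.
Proof.
case: f g => [f fP] [g gP] /= e.
have E : f = g by apply: functional_extensionality_dep => i; apply/funext/e.
by subst g; rewrite (Prop_irrelevance fP gP).
Qed.

Lemma join_mor_inj a b (f : join_mor a b) i : injective (f i).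
Proof.
move=> x y e; apply: val_inj; apply/eqP; case: (ltngtP x y) => // /(join_funP f).
  by rewrite e ltnn.
by rewrite e ltnn.
Qed.

Lemma regular_mor a b : join_mor a b -> regular a -> regular b.
Proof. by move=> f; rewrite /regular => h; exact: leq_trans (ltn_ord (f _ (Ordinal h))). Qed.

Record filtered_face_set := FilteredFaceSet {
  simplices :> join_shape -> Type;
  restr : forall a b, join_mor a b -> simplices b -> simplices a;
  restr_id : forall a (s : simplices a), restr (join_id a) s = s;
  restr_comp : forall a b c (g : join_mor b c) (f : join_mor a b) (s : simplices c),
    restr (join_comp g f) s = restr f (restr g s) }.

End Joins.
Arguments join_id {n} a.
Arguments restr {n} K {a b} : rename.

Section FaceSets.
Variables (n : nat) (K : filtered_face_set n).

Definition simplex : choiceType := {classic {a : join_shape n & K a}}.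
Definition mk_simplex a (s : K a) : simplex := existT _ a s.
Definition sshape (s : simplex) : join_shape n := tag s.
Definition sdim (s : simplex) : nat := join_dim (sshape s).

Lemma mk_simplex_eq a a' b (s : K b) (f : join_mor a b) (f' : join_mor a' b) :
  (forall i, a i = a' i) ->
  (forall i (x : 'I_(a i)) (x' : 'I_(a' i)), x = x' :> nat -> f i x = f' i x' :> nat) ->
  mk_simplex (restr K f s) = mk_simplex (restr K f' s).
Proof.
move=> ea ef; have E : a = a' by apply/val_inj/ffunP.
subst a'; congr (mk_simplex (restr _ _ _)); apply: join_mor_eqP => i x.
by apply: val_inj; exact: ef.
Qed.

(* A simplex may be a face of another one in several ways (face sets are not
   simplicial complexes), so "s is a face of t" carries the face inclusion. *)
Record face_incl (s t : simplex) := FaceIncl {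
  incl :> join_mor (sshape s) (sshape t);
  inclP : restr K incl (tagged t) = tagged s }.

(* Simplices of K_+ having s as a face. *)
Record coface (s : simplex) := Coface {
  coface_simplex :> simplex;
  coface_regular : regular (sshape coface_simplex);
  coface_incl : face_incl s coface_simplex }.

Definition coface_le (s : simplex) (x y : coface s) : Prop :=
  exists v : face_incl x y, join_comp v (coface_incl x) = coface_incl y :> join_mor _ _.

(* The zigzag z 0 <| z 1 |> z 2 <| ... <| z (2m+1) |> z (2m+2) has to respect the
   chosen inclusions of s.  Ignoring them would be too weak: for the triangle
   Delta^1 * Delta^0 with the two vertices of Delta^1 identified, the resulting
   condition holds although the link of the singular vertex is disconnected
   (and the underlying face set has non-zero H^1 while the GM-cohomology for the
   perversity i - 2 vanishes in degree 1). *)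
Definition normal_face_set : Prop :=
  (forall s : simplex, ~~ regular (sshape s) ->
     exists t : simplex, regular (sshape t) /\ inhabited (face_incl s t)) /\
  (forall s : simplex, ~~ regular (sshape s) -> forall x y : coface s,
     exists (m : nat) (z : nat -> coface s),
     [/\ z 0%N = x, z m.*2.+2 = y &
         forall i, (i <= m)%N -> coface_le (z i.*2) (z i.*2.+1)
                              /\ coface_le (z i.*2.+2) (z i.*2.+1)]).

End FaceSets.

Section FreeModules.
Variables (R : idomainType) (T : choiceType) (M : lmodType R) (f : T -> M).

HB.instance Definition _ :=
  GRing.isAdditive.Build {freeg T / R} M (fglift f) (lift_is_additive f).

Lemma fglift_linear : linear (fglift f : {freeg T / R} -> M).
Proof.
move=> a x y; rewrite raddfD /=; congr (_ + _).
transitivity (\sum_(z <- dom x) (a * coeff z x) *: f z).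
  rewrite (_ : a *: x = \sum_(z <- dom x) << a * coeff z x *g z >>) // raddf_sum /=.
  by apply: eq_bigr => z _; rewrite liftU.
rewrite -[x in RHS]freeg_sumE raddf_sum /= scaler_sumr; apply: eq_bigr => z _.
by rewrite liftU scalerA.
Qed.

End FreeModules.

Section Faces.
Variables (n : nat) (a : join_shape n) (l : 'I_n.+1).

Definition face_verts : {ffun 'I_n.+1 -> nat} := [ffun i => a i - (i == l)]%N.

Hypothesis al : (0 < a l)%N.

Lemma sum_face_verts : ((\sum_i face_verts i).+1 = \sum_i a i)%N.
Proof.
rewrite (bigD1 l) //= [RHS](bigD1 l) //= ffunE eqxx -addSn subn1 prednK //.
congr (_ + _)%N; apply: eq_bigr => i /negPf il.
by rewrite ffunE il subn0.
Qed.

Hypothesis a1 : (1 < nvert a)%N.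

Lemma face_verts_gt0 : (0 < \sum_i face_verts i)%N.
Proof. by rewrite -ltnS sum_face_verts. Qed.

Definition face_shape : join_shape n := JoinShape face_verts_gt0.

Variable x : nat.

Definition face_fun i (y : nat) : nat := if i == l then bump x y else y.

Lemma face_fun_lt i (y : 'I_(face_shape i)) : (face_fun i y < a i)%N.
Proof.
case: y => y; rewrite /= ffunE /face_fun; case: eqP => [->|_]; last by rewrite subn0.
by rewrite subn1 /bump; case: (x <= y)%N => /=; case: (a l) al => //= k _ /leqW.
Qed.

Lemma face_fun_mono i : {mono face_fun i : y z / (y < z)%N}.
Proof.
move=> y z; rewrite /face_fun; case: eqP => // _.
by rewrite !ltnNge leq_bump2.
Qed.

Definition face_mor : join_mor face_shape a :=
  @JoinMor n face_shape a (fun i y => Ordinal (face_fun_lt y))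
    (fun i y z yz => etrans (face_fun_mono i y z) yz).

End Faces.

Section Chains.
Variables (R : idomainType) (n : nat) (K : filtered_face_set n).
Local Notation simplex := (simplex K).
Local Notation chains := {freeg simplex / R}.

Definition vertex_gt0 (s : simplex) l (x : 'I_(sshape s l)) : (0 < sshape s l)%N :=
  leq_ltn_trans (leq0n x) (ltn_ord x).

Definition face (s : simplex) (s1 : (1 < nvert (sshape s))%N) l (x : 'I_(sshape s l)) :
  simplex := mk_simplex (restr K (face_mor (vertex_gt0 x) s1 x) (tagged s)).

(* Position in the vertex order of the join of vertex x of the factor l. *)
Definition vertex_pos (a : {ffun 'I_n.+1 -> nat}) (l : 'I_n.+1) (x : nat) : nat :=
  (\sum_(i < n.+1 | (i < l)%N) a i + x)%N.

Definition simplex_boundary (s : simplex) : chains :=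
  match pselect (1 < nvert (sshape s))%N with
  | left s1 => \sum_(l < n.+1) \sum_(x < sshape s l)
      (-1) ^+ vertex_pos (sshape s) l x *: << face s1 x >>
  | right _ => 0
  end.

Definition chain_boundary (c : chains) : chains := fglift simplex_boundary c.

HB.instance Definition _ := GRing.isLinear.Build R chains chains _ chain_boundary
  (fglift_linear simplex_boundary).

Lemma chain_boundaryU s : chain_boundary << s >> = simplex_boundary s.
Proof. by rewrite /chain_boundary liftU scale1r. Qed.

End Chains.

Lemma antisym_sum (V : zmodType) m (S : 'I_m -> 'I_m -> V) :
  (forall i, S i i = 0) -> (forall i j : 'I_m, (i < j)%N -> S i j + S j i = 0) ->
  \sum_i \sum_j S i j = 0.
Proof.
move=> Sii Sij; under eq_bigr => i _ do
  rewrite (bigID (fun j : 'I_m => (i < j)%N)) /= (bigID (fun j : 'I_m => (j < i)%N) (fun j : 'I_m => ~~ (i < j)%N)) /=.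
rewrite big_split /= big_split /= [X in _ + (_ + X)]big1 ?addr0; last first.
  move=> i _; apply: big1 => j; rewrite -!leqNgt => ij.
  by have -> : j = i by apply/val_inj/anti_leq.
rewrite [X in _ + X](eq_bigr (fun i : 'I_m => \sum_(j < m | (j < i)%N) S i j)); last first.
  move=> i _; apply: eq_bigl => j; rewrite -leqNgt.
  by case: ltnP => h; rewrite ?andbF // (ltnW h).
rewrite [X in _ + X](exchange_big_dep predT) //= -big_split /= big1 // => i _.
by rewrite -big_split /= big1 // => j; exact: Sij.
Qed.

Lemma simplicial_cancel (V : zmodType) N (g : nat -> nat -> V) :
  (forall x y, (y < x < N)%N -> g x y = - g y x.-1) ->
  \sum_(0 <= x < N) \sum_(0 <= y < N.-1) g x y = 0.
Proof.
case: N => [|N] gE; first by rewrite big_nil.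
rewrite !big_mkord /=; under eq_bigr => x _ do rewrite big_mkord (bigID (fun y : 'I_N => (x <= y)%N)) /=.
rewrite big_split /= [X in _ + X]big_ord_recl /= [X in _ + (X + _)]big1 ?add0r; last first.
  by [].
rewrite (exchange_big_dep predT) //= [X in _ + X](_ : _ =
    - \sum_(y < N) \sum_(x < N.+1 | (x <= y)%N) g x y); last first.
  rewrite -sumrN; apply: eq_bigr => x _; rewrite -sumrN.
  rewrite (big_mkcond (fun y : 'I_N => _)) [RHS]big_mkcond /= [RHS]big_ord_recr /=.
  rewrite [X in _ + X]ifF ?addr0; last by rewrite leqNgt ltn_ord.
  apply: eq_bigr => y _; rewrite /bump leq0n add1n -leqNgt.
  case: ltnP => //= yx; rewrite gE //.
  by rewrite ltnS yx /= ltnS ltn_ord.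
by rewrite addrN.
Qed.

Section BoundarySquare.
Variables (R : idomainType) (n : nat) (K : filtered_face_set n).
Local Notation simplex := (simplex K).
Local Notation chains := {freeg simplex / R}.
Implicit Type s : simplex.

Lemma simplex_boundaryE s (s1 : (1 < nvert (sshape s))%N) :
  simplex_boundary R s = \sum_(l < n.+1) \sum_(x < sshape s l)
      (-1) ^+ vertex_pos (sshape s) l x *: << face s1 x >>.
Proof.
rewrite /simplex_boundary; case: pselect => // s1'.
by rewrite (bool_irrelevance s1' s1).
Qed.

Lemma simplex_boundary0 s : ~~ (1 < nvert (sshape s))%N -> simplex_boundary R s = 0.
Proof. by move=> h; rewrite /simplex_boundary; case: pselect => // h1; rewrite h1 in h. Qed.

Lemma nvert_face s (s1 : (1 < nvert (sshape s))%N) l (x : 'I_(sshape s l)) :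
  (nvert (sshape (face s1 x))).+1 = nvert (sshape s).
Proof. exact: sum_face_verts (vertex_gt0 x). Qed.

Lemma face_gt1 s (s1 : (1 < nvert (sshape s))%N) (s2 : (2 < nvert (sshape s))%N)
  l (x : 'I_(sshape s l)) : (1 < nvert (sshape (face s1 x)))%N.
Proof. by rewrite -ltnS nvert_face. Qed.

Variables (s : simplex) (s1 : (1 < nvert (sshape s))%N) (s2 : (2 < nvert (sshape s))%N).
Local Notation a := (sshape s).

Definition double_face l x m y : chains :=
  if (insub x : option 'I_(a l)) is Some x' then
    if (insub y : option 'I_(sshape (face s1 x') m)) is Some y' then
      << face (face_gt1 s1 s2 x') y' >>
    else 0
  else 0.

Lemma double_faceE l (x : 'I_(a l)) m (y : 'I_(sshape (face s1 x) m)) :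
  double_face l x m y = << face (face_gt1 s1 s2 x) y >>.
Proof. by rewrite /double_face !valK. Qed.

Lemma face_fun_comm (l m : 'I_n.+1) (x y x' y' : nat) :
  (if l == m then [&& y < x, x' == y & y' == x.-1]
   else (x' == y) && (y' == x))%N ->
  forall i z, face_fun l x i (face_fun m y i z) = face_fun m x' i (face_fun l y' i z).
Proof.
rewrite /face_fun; case: (l =P m) => [<-|lm].
  by move=> /and3P[yx /eqP-> /eqP->] i z; case: (i == l) => //; rewrite /bump; lia.
move=> /andP[/eqP-> /eqP->] i z; case: (i =P l) => [->|//].
by case: eqP.
Qed.

Lemma face_face l (x : 'I_(a l)) m (y : 'I_(sshape (face s1 x) m))
    (x' : 'I_(a m)) (y' : 'I_(sshape (face s1 x') l)) :
  (if l == m then [&& y < x, x' == y :> nat & y' == x.-1 :> nat]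
   else (x' == y :> nat) && (y' == x :> nat))%N ->
  face (face_gt1 s1 s2 x) y = face (face_gt1 s1 s2 x') y'.
Proof.
move=> H; rewrite /face /= -!restr_comp; apply: mk_simplex_eq => i.
  by rewrite /= !ffunE -!subnDA addnC.
by move=> z z' /= ->; exact: face_fun_comm.
Qed.

Lemma double_face_swap l m x y : l != m -> (x < a l)%N -> (y < a m)%N ->
  double_face l x m y = double_face m y l x.
Proof.
move=> lm xl ym; pose x1 := Ordinal xl; pose y1 := Ordinal ym.
have yf : (y < sshape (face s1 x1) m)%N by rewrite /= ffunE eq_sym (negPf lm) subn0.
have xf : (x < sshape (face s1 y1) l)%N by rewrite /= ffunE (negPf lm) subn0.
apply: etrans (@double_faceE l x1 m (Ordinal yf)) _.
apply: etrans _ (esym (@double_faceE m y1 l (Ordinal xf))).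
by congr << _ >>; apply: face_face; rewrite (negPf lm) /= !eqxx.
Qed.

Lemma double_face_simplicial l x y : (y < x < a l)%N ->
  double_face l x l y = double_face l y l x.-1.
Proof.
move=> /andP[yx xl]; pose x1 := Ordinal xl; pose y1 := Ordinal (ltn_trans yx xl).
have yf : (y < sshape (face s1 x1) l)%N by rewrite /= ffunE eqxx; lia.
have xf : (x.-1 < sshape (face s1 y1) l)%N by rewrite /= ffunE eqxx; lia.
apply: etrans (@double_faceE l x1 l (Ordinal yf)) _.
apply: etrans _ (esym (@double_faceE l y1 l (Ordinal xf))).
by congr << _ >>; apply: face_face; rewrite eqxx /= yx !eqxx.
Qed.

Definition double_term l m : chains :=
  \sum_(0 <= x < a l) \sum_(0 <= y < a m - (m == l))
    (-1) ^+ (vertex_pos a l x + vertex_pos (face_verts a l) m y) *: double_face l x m y.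

Lemma vertex_pos_face l m y : (0 < a l)%N ->
  (vertex_pos (face_verts a l) m y + (l < m))%N = vertex_pos a m y.
Proof.
move=> al; rewrite /vertex_pos addnAC; congr (_ + _)%N.
case: (ltnP l m) => lm; last first.
  rewrite addn0; apply: eq_bigr => i im; rewrite ffunE.
  by rewrite (_ : i == l = false) ?subn0 //; apply/eqP => il; move: im; rewrite il ltnNge lm.
rewrite (bigD1 l) //= [RHS](bigD1 l) //= ffunE eqxx addnAC subn1 addn1 prednK //.
by congr (_ + _)%N; apply: eq_bigr => i /andP[_ /negPf il]; rewrite ffunE il subn0.
Qed.

Lemma double_term_diag l : double_term l l = 0.
Proof.
rewrite /double_term eqxx subn1; apply: simplicial_cancel => x y /andP[yx xl].
rewrite double_face_simplicial ?yx // -scaleNr; congr (_ *: _).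
have al : (0 < a l)%N by lia.
have e z := vertex_pos_face l z al; rewrite ltnn in e.
rewrite -[vertex_pos (face_verts _ _) _ _]addn0 e -[vertex_pos (face_verts _ _) _ _]addn0 e.
by rewrite /vertex_pos -[x]prednK /=; [rewrite !addnS addSn exprS mulN1r addnAC addnCA; congr (- _ ^+ _); lia | lia].
Qed.

Lemma double_term_anti (l m : 'I_n.+1) : (l < m)%N -> double_term l m + double_term m l = 0.
Proof.
move=> lm; rewrite /double_term; have nlm : l != m by apply: contraTneq lm => ->; rewrite ltnn.
rewrite (negPf nlm) eq_sym (negPf nlm) !subn0 [X in _ + X]exchange_big_nat /=.
rewrite -big_split /= big1_seq // => x /andP[_]; rewrite mem_index_iota => /andP[_ xl].
rewrite -big_split /= big1_seq // => y /andP[_]; rewrite mem_index_iota => /andP[_ ym].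
rewrite double_face_swap // -scalerDl.
rewrite -(vertex_pos_face m y (leq_ltn_trans (leq0n x) xl)) lm.
rewrite -(vertex_pos_face l x (leq_ltn_trans (leq0n y) ym)) ltnNge (ltnW lm) /= addn0.
by rewrite addn1 addSn exprS mulN1r addnC subrr scale0r.
Qed.

Lemma sum_double_face :
  \sum_(l < n.+1) \sum_(x < a l) (-1) ^+ vertex_pos a l x *: simplex_boundary R (face s1 x) = 0.
Proof.
rewrite -[RHS](antisym_sum double_term_diag double_term_anti).
apply: eq_bigr => l _; rewrite /double_term.
under [RHS]eq_bigr => m _ do rewrite big_mkord.
rewrite exchange_big /=; apply: eq_bigr => x _.
rewrite (simplex_boundaryE (face_gt1 s1 s2 x)) scaler_sumr; apply: eq_bigr => m _.
rewrite (_ : a m - (m == l) = sshape (face s1 x) m)%N; last by rewrite /= ffunE.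
rewrite big_mkord scaler_sumr; apply: eq_bigr => y _.
by rewrite scalerA -exprD double_faceE.
Qed.

End BoundarySquare.

Section GMChains.
Variables (R : idomainType) (n : nat) (K : filtered_face_set n).
Local Notation chains := {freeg (simplex K) / R}.

Lemma chain_boundary_boundary (c : chains) : chain_boundary (chain_boundary c) = 0.
Proof.
rewrite -[c]freeg_sumE !linear_sum /= big1 // => s _.
rewrite (_ : << _ *g s >> = coeff s c *: << s >>); last first.
  by apply/eqP/freeg_eqP => t; rewrite coeffZ !coeffU mul1r.
rewrite !linearZ /= chain_boundaryU (_ : chain_boundary _ = 0) ?scaler0 //.
case: (boolP (1 < nvert (sshape s))%N) => s1; last by rewrite simplex_boundary0 ?linear0.
rewrite (simplex_boundaryE _ s1) linear_sum /=.
under eq_bigr => l _ do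
  (rewrite linear_sum /=; under eq_bigr => x _ do rewrite linearZ /= chain_boundaryU).
case: (boolP (2 < nvert (sshape s))%N) => s2; first exact: sum_double_face.
rewrite big1 // => l _; rewrite big1 // => x _.
by rewrite simplex_boundary0 ?scaler0 // -ltnS nvert_face.
Qed.

End GMChains.

Section GMCohomology.
Variables (R : idomainType) (n : nat) (K : filtered_face_set n).
Local Notation simplex := (simplex K).
Local Notation chains := {freeg simplex / R}.

Lemma dom_chain_boundary (c : chains) k :
  all (fun s => sdim s == k.+1) (dom c) -> all (fun s => sdim s == k) (dom (chain_boundary c)).
Proof.
move=> /allP ck; rewrite -[c]freeg_sumE linear_sum /= big_seq.
apply: (big_ind (fun b : chains => all (fun s => sdim s == k) (dom b))).
- by rewrite dom0.
- by move=> x y /allP hx /allP hy; apply/allP => s /domD_subset; rewrite mem_cat => /orP[/hx|/hy].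
move=> s /ck sk; rewrite /chain_boundary liftU; apply/allP => t /domZ_subset.
have s1 : (1 < nvert (sshape s))%N by move: sk; rewrite /sdim /join_dim; lia.
rewrite (simplex_boundaryE _ s1) => /dom_sum_subset /flattenP[? /mapP[l _ ->]] /=.
move=> /dom_sum_subset /flattenP[? /mapP[x _ ->]] /= /domZ_subset.
rewrite domU1 inE => /eqP->; have := nvert_face s1 x.
by move: sk; rewrite /sdim /join_dim; lia.
Qed.

Section Supported.
Variable P : pred simplex.

(* Chains c of degree k such that c and its boundary are linear combinations of
   simplices satisfying P. *)
Lemma supported_closed k : submod_closed (fun c : chains =>
  [&& all (fun s => sdim s == k) (dom c), all P (dom c) & all P (dom (chain_boundary c))]).
Proof.
have H Q (a : R) (c e : chains) : all Q (dom c) -> all Q (dom e) -> all Q (dom (a *: c + e)).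
  move=> /allP hc /allP he; apply/allP => s /domD_subset; rewrite mem_cat.
  by case/orP => [/domZ_subset/hc|/he].
split=> [|a c e]; rewrite !unfold_in; first by rewrite linear0 dom0.
by move=> /and3P[c1 c2 c3] /and3P[e1 e2 e3]; rewrite linearP /= !H.
Qed.

Definition supported_chain k := submod (Submodule (supported_closed k)).

Lemma supported_boundary_subproof k (c : supported_chain k.+1) :
  chain_boundary (val c) \in spred (Submodule (supported_closed k)).
Proof.
have /and3P[c1 c2 c3] := submodP c; apply/and3P; split=> //.
  exact: dom_chain_boundary.
by rewrite chain_boundary_boundary dom0.
Qed.

Definition supported_boundary k (c : supported_chain k.+1) : supported_chain k :=
  Submod (supported_boundary_subproof c).

Lemma supported_boundary_linear k : linear (@supported_boundary k).
Proof. by move=> a c e; apply: val_inj; rewrite /= linearP. Qed.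
HB.instance Definition _ k := GRing.isLinear.Build R _ _ _ (@supported_boundary k)
  (@supported_boundary_linear k).

Lemma supported_boundary2 k (c : supported_chain k.+2) :
  supported_boundary (supported_boundary c) = 0.
Proof. by apply: val_inj; rewrite /= chain_boundary_boundary. Qed.

Definition supported_complex : chain_complex R :=
  @ChainComplex R (fun k => supported_chain k) (fun k => @supported_boundary k)
    supported_boundary2.

End Supported.

Definition gm_norm (l : nat) (a : join_shape n) : \bar int :=
  let v := (\sum_(i < n.+1 | i <= n - l) a i)%N in
  if v == 0%N then -oo%E else (v.-1%:Z)%:E.

Definition gm_admissible (p : nat -> int) : pred simplex := fun s =>
  [forall l : 'I_n.+1, (0 < l)%N ==>
     (gm_norm l (sshape s) <= ((sdim s)%:Z - l%:Z + p l)%:E)%E].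

Definition gm_chain_complex (p : nat -> int) := supported_complex (gm_admissible p).
Definition simplicial_chain_complex := supported_complex predT.

End GMCohomology.

Section FactorCochains.
Variable R : idomainType.

(* Non-empty faces of the simplex with m vertices (dimension m - 1); simplicial
   cochains of that simplex are the functions sface m -> R. *)
Record sface (m : nat) := SFace { verts :> {set 'I_m}; verts_neq0 : verts != set0 }.
HB.instance Definition _ m := [isSub for @verts m].
HB.instance Definition _ m := [Finite of sface m by <:].

Definition sface_dim m (F : sface m) : nat := #|F|.-1.

Definition face_ext m (f : sface m -> R) (A : {set 'I_m}) : R := oapp f 0 (insub A).

(* (d f)(F) = sum over v in F of (-1)^(position of v in F) f(F \ v), with the
   convention f(empty) = 0. *)
Definition cobd m (f : sface m -> R) (F : sface m) : R :=
  \sum_(v in verts F) (-1) ^+ #|[set u in verts F | (u < v)%N]| * face_ext f (F :\ v).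

Lemma face_ext0 m (f : sface m -> R) : face_ext f set0 = 0.
Proof. by rewrite /face_ext; case: insubP => //=; rewrite eqxx. Qed.

Lemma face_extE m (f : sface m -> R) (F : sface m) : face_ext f F = f F.
Proof. by rewrite /face_ext -[verts F]/(val F) valK. Qed.

Lemma sface_image_subproof m q (f : 'I_m -> 'I_q) (F : sface m) : f @: F != set0.
Proof. by have /set0Pn[v vF] := verts_neq0 F; apply/set0Pn; exists (f v); exact: imset_f. Qed.

Definition sface_image m q (f : 'I_m -> 'I_q) (F : sface m) : sface q :=
  SFace (sface_image_subproof f F).

Lemma cobd_linear m a (f g : sface m -> R) F :
  cobd (fun G => a * f G + g G) F = a * cobd f F + cobd g F.
Proof.
rewrite /cobd mulr_sumr -big_split /=; apply: eq_bigr => v _.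
by rewrite /face_ext; case: insub => [G|] /=; ring.
Qed.

Lemma eq_cobd m (f g : sface m -> R) (F : sface m) :
  (forall G : sface m, #|G|.+1 = #|F| -> f G = g G) -> cobd f F = cobd g F.
Proof.
move=> e; apply: eq_bigr => v vF; congr (_ * _).
have [->|A0] := eqVneq (verts F :\ v) set0; first by rewrite !face_ext0.
rewrite -[_ :\ _]/(verts (SFace A0)) !face_extE; apply: e.
by rewrite /= [RHS](cardsD1 v) vF.
Qed.

Lemma cobd_image m q (f : 'I_m -> 'I_q) (w : sface q -> R) (F : sface m) :
  (forall x y : 'I_m, (x < y)%N -> (f x < f y)%N) ->
  cobd (fun G => w (sface_image f G)) F = cobd w (sface_image f F).
Proof.
move=> fm; have fmono (x y : 'I_m) : (f x < f y)%N = (x < y)%N.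
  case: (ltngtP x y) => [/fm //|/fm|/val_inj->]; last by rewrite ltnn.
  by move/ltnW; rewrite leqNgt => /negPf.
have finj : injective f.
  by move=> x y e; apply/val_inj; case: (ltngtP x y) => // /fm; rewrite e ltnn.
rewrite /cobd /= big_imset /=; last by move=> x y _ _; exact: finj.
apply: eq_bigr => v vF; congr (_ ^+ _ * _).
  rewrite -(card_imset _ finj); apply: eq_card => u; rewrite !inE.
  apply/imsetP/andP => [[x]|[/imsetP[x xF ->]]].
    by rewrite !inE => /andP[xF xv] ->; rewrite fmono imset_f.
  by rewrite fmono => xv; exists x; rewrite ?inE ?xF.
have -> : f @: F :\ f v = f @: (verts F :\ v).
  apply/setP => u; rewrite !inE; apply/andP/imsetP => [[uv /imsetP[x xF E]]|[x]].
    by exists x => //; rewrite !inE xF andbT; apply: contraNneq uv => xv; rewrite E xv.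
  by rewrite !inE => /andP[xv xF] ->; rewrite (inj_eq finj) xv imset_f.
have [->|A0] := eqVneq (verts F :\ v) set0; first by rewrite imset0 !face_ext0.
rewrite -[_ :\ _]/(verts (SFace A0)) face_extE.
by rewrite -[f @: _]/(verts (sface_image f (SFace A0))) face_extE.
Qed.

Lemma cobd_cobd m (f : sface m -> R) F : cobd (cobd f) F = 0.
Proof.
pose pos (A : {set 'I_m}) (v : 'I_m) := #|[set u in A | (u < v)%N]|.
have posE (A : {set 'I_m}) (u v : 'I_m) : u \in A ->
    pos A v = ((u < v) + pos (A :\ u) v)%N.
  move=> uA; rewrite /pos (cardsD1 u) !inE uA /=; congr (_ + _)%N.
  by apply: eq_card => z; rewrite !inE andbA.
transitivity (\sum_(v in verts F) \sum_(u in verts F :\ v)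
    (-1) ^+ (pos F v + pos (verts F :\ v) u) * face_ext f (verts F :\ v :\ u)).
  apply: eq_bigr => v vF.
  have [->|A0] := eqVneq (verts F :\ v) set0; first by rewrite face_ext0 mulr0 big_set0.
  rewrite -[_ :\ v]/(verts (SFace A0)) face_extE /cobd mulr_sumr.
  by apply: eq_bigr => u _; rewrite mulrA -exprD.
pose S (v u : 'I_m) : R := if (v \in verts F) && (u \in verts F :\ v) then
  (-1) ^+ (pos F v + pos (verts F :\ v) u) * face_ext f (verts F :\ v :\ u) else 0.
transitivity (\sum_v \sum_u S v u).
  rewrite big_mkcond /=; apply: eq_bigr => v _; rewrite /S; case: (v \in verts F) => /=.
    by rewrite big_mkcond.
  by rewrite big1.
apply: antisym_sum => [v|v u vu]; first by rewrite /S !inE eqxx andbF.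
rewrite /S !inE; have nuv : u != v by apply: contraTneq vu => ->; rewrite ltnn.
rewrite nuv eq_sym nuv /= [in X in _ + X]andbC.
case: ifP => [/andP[vF uF]|_]; last by rewrite addr0.
rewrite (_ : verts F :\ u :\ v = verts F :\ v :\ u); last first.
  by apply/setP => z; rewrite !inE andbCA.
rewrite (posE _ v u vF) vu (posE _ u v uF) (ltnNge u v) (ltnW vu) /= add0n.
rewrite -mulrDl (_ : (-1) ^+ _ + _ = 0) ?mul0r //.
by rewrite [(pos (_ :\ u) v + _)%N]addnC -addnA add1n exprS mulN1r subrr.
Qed.

End FactorCochains.

Section TWTensor.
Variables (R : idomainType) (n : nat).
Implicit Types a b : join_shape n.

(* Vertices of the factor i of the blow-up: c Delta^{j_i} for i < n, with cone
   point the last vertex a i, and Delta^{j_n} for i = n. *)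
Definition cone_nverts a (i : 'I_n.+1) : nat := (a i + (i != ord_max))%N.

Definition cone_map a b (f : join_mor a b) i (v : 'I_(cone_nverts a i)) :
  'I_(cone_nverts b i) :=
  unsplit (match split v with inl u => inl (f i u) | inr c => inr c end).

Definition cell a := {dffun forall i : 'I_n.+1, sface (cone_nverts a i)}.

Definition cell_set a (F : cell a) i (G : sface (cone_nverts a i)) : cell a :=
  finfun (dfwith F G).

Definition cell_image a b (f : join_mor a b) (F : cell a) : cell b :=
  finfun (fun i => sface_image (cone_map f (i := i)) (F i)).

Definition cell_dim a (F : cell a) : nat := (\sum_i sface_dim (F i))%N.

(* Each C^*(c Delta^{j_i}) is free on the dual basis of the faces, so the tensor
   product over R is the free module on cells, see pure_tensor for the elementary
   tensors. *)
Definition tw_tensor a : lmodType R := {ffun cell a -> R^o}.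

Definition tw_pull a b (f : join_mor a b) (w : tw_tensor b) : tw_tensor a :=
  [ffun F => w (cell_image f F)].

Definition tw_diff a (w : tw_tensor a) : tw_tensor a := [ffun F : cell a =>
  \sum_(i < n.+1) (-1) ^+ (\sum_(j < n.+1 | (j < i)%N) sface_dim (F j))
     * @cobd R _ (fun G : sface (cone_nverts a i) => w (cell_set F G)) (F i)].

Definition pure_tensor a (f : forall i, sface (cone_nverts a i) -> R) : tw_tensor a :=
  [ffun F : cell a => \prod_i f i (F i)].

Lemma cell_set_in a (F : cell a) i G : cell_set F G i = G.
Proof. by rewrite ffunE dfwith_in. Qed.

Lemma cell_set_out a (F : cell a) i (G : sface (cone_nverts a i)) j :
  i != j -> cell_set F G j = F j.
Proof. by move=> ij; rewrite ffunE dfwith_out. Qed.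

(* tw_diff is the differential of the tensor product of cochain complexes. *)
Lemma tw_diff_pure a (f : forall i, sface (cone_nverts a i) -> R) (e : 'I_n.+1 -> nat) :
  (forall i F, f i F != 0 -> sface_dim F = e i) ->
  tw_diff (pure_tensor f) = \sum_(i < n.+1) (-1) ^+ (\sum_(j < n.+1 | (j < i)%N) e j) *:
    pure_tensor (dfwith f (fun F : sface (cone_nverts a i) => cobd (f i) F)).
Proof.
move=> fe; apply/ffunP => F; rewrite !ffunE sum_ffunE; apply: eq_bigr => i _.
rewrite !ffunE /=.
have -> : @cobd R _ (fun G : sface (cone_nverts a i) => pure_tensor f (cell_set F G)) (F i)
    = (\prod_(j < n.+1 | j != i) f j (F j)) * cobd (f i) (F i).
  rewrite /cobd mulr_sumr; apply: eq_bigr => v _; rewrite mulrCA; congr (_ * _).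
  rewrite /face_ext; case: insub => [G|] /=; last by rewrite mulr0.
  rewrite ffunE (bigD1 i) //= cell_set_in mulrC; congr (_ * _).
  by apply: eq_bigr => j ji; rewrite cell_set_out // eq_sym.
have -> : \prod_(j < n.+1) dfwith f (fun F : sface (cone_nverts a i) => cobd (f i) F) j (F j)
    = (\prod_(j < n.+1 | j != i) f j (F j)) * cobd (f i) (F i).
  rewrite (bigD1 i) //= dfwith_in mulrC; congr (_ * _).
  by apply: eq_bigr => j ji; rewrite dfwith_out // eq_sym.
have [->|] := eqVneq (\prod_(j < n.+1 | j != i) f j (F j)) 0.
  by rewrite mul0r mulr0 scaler0.
move=> /prodf_neq0 nz; congr (_ ^+ _ * _); apply: eq_bigr => j ji.
apply: fe; apply: nz => //.
by apply: contraTneq ji => ->; rewrite ltnn.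
Qed.

Lemma tw_pull_pure a b (f : join_mor a b) (g : forall i, sface (cone_nverts b i) -> R) :
  tw_pull f (pure_tensor g) =
  pure_tensor (fun i (F : sface (cone_nverts a i)) => g i (sface_image (cone_map f (i := i)) F)).
Proof. by apply/ffunP => F; rewrite !ffunE; apply: eq_bigr => i _; rewrite ffunE. Qed.

Lemma cone_map_mono a b (f : join_mor a b) i (x y : 'I_(cone_nverts a i)) :
  (x < y)%N -> (cone_map f x < cone_map f y)%N.
Proof.
rewrite /cone_map; case: splitP => u ->; case: splitP => v -> /=.
- exact: join_funP.
- by move=> _; rewrite (leq_trans (ltn_ord _)) // leq_addr.
- by rewrite ltnNge ltnW // (leq_trans (ltn_ord _)) // leq_addr.
- by rewrite !ltn_add2l.
Qed.

Lemma cone_map_inj a b (f : join_mor a b) i : injective (cone_map f (i := i)).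
Proof.
move=> x y e; apply/val_inj; case: (ltngtP x y) => // /(cone_map_mono f).
  by rewrite e ltnn.
by rewrite e ltnn.
Qed.

Lemma sface_dim_image m q (f : 'I_m -> 'I_q) (F : sface m) :
  injective f -> sface_dim (sface_image f F) = sface_dim F.
Proof. by move=> fi; rewrite /sface_dim card_imset. Qed.

Lemma tw_pull_diff a b (f : join_mor a b) (w : tw_tensor b) :
  tw_diff (tw_pull f w) = tw_pull f (tw_diff w).
Proof.
apply/ffunP => F; rewrite !ffunE; apply: eq_bigr => i _.
congr (_ ^+ _ * _).
  apply: eq_bigr => j _; rewrite ffunE sface_dim_image //.
  exact: cone_map_inj.
rewrite ffunE -cobd_image; last exact: cone_map_mono.
apply: eq_cobd => G _; rewrite ffunE; congr (w _); apply/ffunP => j.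
rewrite [LHS]ffunE; have [<-|ij] := eqVneq i j; first by rewrite !cell_set_in.
by rewrite !cell_set_out // ffunE.
Qed.

Lemma tw_diff_linear a : linear (@tw_diff a).
Proof.
move=> c w1 w2; apply/ffunP => F; rewrite !ffunE scaler_sumr -big_split /=.
apply: eq_bigr => i _.
rewrite (@eq_cobd R _ _ (fun G : sface (cone_nverts a i) =>
  c * w1 (cell_set F G) + w2 (cell_set F G)) (F i)).
  by rewrite cobd_linear mulrDr mulrCA.
by move=> G _; rewrite !ffunE.
Qed.
HB.instance Definition _ a := GRing.isLinear.Build R _ _ _ (@tw_diff a) (@tw_diff_linear a).

Lemma cell_setC a (F : cell a) i j (G : sface (cone_nverts a i)) (H : sface (cone_nverts a j)) :
  i != j -> cell_set (cell_set F G) H = cell_set (cell_set F H) G.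
Proof.
move=> ij; apply/ffunP => k; have [<-|jk] := eqVneq j k.
  by rewrite cell_set_in cell_set_out // cell_set_in.
rewrite cell_set_out //; have [<-|ik] := eqVneq i k; first by rewrite !cell_set_in.
by rewrite !cell_set_out.
Qed.

Lemma cell_set_set a (F : cell a) i (G H : sface (cone_nverts a i)) :
  cell_set (cell_set F G) H = cell_set F H.
Proof.
apply/ffunP => k; have [<-|ik] := eqVneq i k; first by rewrite !cell_set_in.
by rewrite !cell_set_out.
Qed.

Lemma cobdC m q (f : sface m -> sface q -> R) F G :
  cobd (fun F' => cobd (f F') G) F = cobd (fun G' => cobd (fun F' => f F' G') F) G.
Proof.
have E p (g : sface p -> R) H : cobd g H = \sum_(F' : sface p)
    (\sum_(v in verts H | verts H :\ v == F') (-1) ^+ #|[set u in verts H | (u < v)%N]|) * g F'.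
  rewrite /cobd; under [RHS]eq_bigr => F' _ do rewrite mulr_suml big_mkcondr /=.
  rewrite exchange_big /=; apply: eq_bigr => v _.
  have [A0|A0] := eqVneq (verts H :\ v) set0.
    rewrite A0 face_ext0 mulr0 big1 // => F' _.
    by rewrite eq_sym (negPf (verts_neq0 F')).
  rewrite (bigD1 (SFace A0)) //= eqxx -[_ :\ _ in LHS]/(verts (SFace A0)) face_extE.
  rewrite big1 ?addr0 // => F' F'A; rewrite ifF //; apply: contraNF F'A => /eqP e.
  by apply/eqP/val_inj.
rewrite !E; under eq_bigr => F' _ do rewrite E mulr_sumr.
rewrite exchange_big /=; apply: eq_bigr => G' _; rewrite E mulr_sumr.
by apply: eq_bigr => F' _; rewrite mulrCA.
Qed.

Lemma cobdZ m c (f : sface m -> R) F : cobd (fun G => c * f G) F = c * cobd f F.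
Proof.
rewrite /cobd mulr_sumr; apply: eq_bigr => v _; rewrite mulrCA; congr (_ * _).
by rewrite /face_ext; case: insub => [G|] /=; rewrite ?mulr0.
Qed.

Lemma cobd_sum (I : finType) m (f : I -> sface m -> R) F :
  cobd (fun G => \sum_i f i G) F = \sum_i cobd (f i) F.
Proof.
rewrite /cobd exchange_big /=; apply: eq_bigr => v _; rewrite -mulr_sumr; congr (_ * _).
rewrite /face_ext; case: insub => [G|] //=.
by rewrite big1.
Qed.

Lemma tw_diff2 a (w : tw_tensor a) : tw_diff (tw_diff w) = 0.
Proof.
apply/ffunP => F; rewrite [LHS]ffunE [RHS]ffunE.
pose deg (F : cell a) i := (\sum_(j < n.+1 | (j < i)%N) sface_dim (F j))%N.
pose S (i j : 'I_n.+1) : R := (-1) ^+ deg F i * @cobd R _ (fun G : sface (cone_nverts a i) =>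
   (-1) ^+ deg (cell_set F G) j * @cobd R _ (fun H : sface (cone_nverts a j) =>
      w (cell_set (cell_set F G) H)) (cell_set F G j)) (F i).
transitivity (\sum_i \sum_j S i j).
  apply: eq_bigr => i _; rewrite -mulr_sumr -cobd_sum; congr (_ * _).
  by apply: eq_cobd => G _; rewrite ffunE.
have degE (i j : 'I_n.+1) (G : sface (cone_nverts a i)) : (j <= i)%N -> deg (cell_set F G) j = deg F j.
  move=> ji; apply: eq_bigr => k kj; rewrite cell_set_out //.
  by apply: contraTneq kj => <-; rewrite -leqNgt.
have degS (i j : 'I_n.+1) (G : sface (cone_nverts a i)) : (i < j)%N -> #|G|.+1 = #|F i| ->
    deg F j = (deg (cell_set F G) j).+1.
  move=> ij GF; rewrite /deg (bigD1 i) //= [in RHS](bigD1 i) //= cell_set_in -addSn.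
  rewrite /sface_dim -GF /= prednK ?card_gt0 ?verts_neq0 //; congr (_ + _)%N.
  by apply: eq_bigr => k /andP[_ ki]; rewrite cell_set_out // eq_sym.
apply: antisym_sum => [i|i j ij].
  rewrite /S (eq_cobd (g := fun G => (-1) ^+ deg F i *
     @cobd R _ (fun H : sface (cone_nverts a i) => w (cell_set F H)) G)).
    by rewrite cobdZ cobd_cobd !mulr0.
  move=> G _; rewrite degE // cell_set_in; congr (_ * _).
  by apply: eq_cobd => H _; rewrite cell_set_set.
have nij : i != j by apply: contraTneq ij => ->; rewrite ltnn.
pose D := @cobd R _ (fun G : sface (cone_nverts a i) => @cobd R _ (fun H : sface (cone_nverts a j) =>
      w (cell_set (cell_set F G) H)) (F j)) (F i).
have -> : S i j = - ((-1) ^+ deg F i * ((-1) ^+ deg F j * D)).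
  rewrite /S -mulrN -mulNr -[X in _ = _ * X]cobdZ; congr (_ * _); apply: eq_cobd => G GF.
  by rewrite cell_set_out // (degS _ _ G) // exprS mulN1r opprK.
rewrite /S (eq_cobd (g := fun H => (-1) ^+ deg F i * @cobd R _ (fun G : sface (cone_nverts a i) =>
      w (cell_set (cell_set F G) H)) (F i))); last first.
  move=> H _; rewrite degE ?(ltnW ij) // cell_set_out; last by rewrite eq_sym.
  by congr (_ * _); apply: eq_cobd => G _; rewrite cell_setC // eq_sym.
by rewrite cobdZ -cobdC mulrCA addNr.
Qed.

Lemma tw_diff_homog a (w : tw_tensor a) k :
  (forall F, w F != 0 -> cell_dim F = k) -> forall F, tw_diff w F != 0 -> cell_dim F = k.+1.
Proof.
move=> wk F; rewrite ffunE => nz; apply/eqP; apply: contraNT nz => Fk.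
apply/eqP/big1 => i _; rewrite (eq_cobd (g := fun=> 0)) => [|G GF].
  rewrite [X in _ * X](_ : _ = 0) ?mulr0 // /cobd big1 // => v _.
  by rewrite /face_ext; case: insub => [G|] /=; rewrite mulr0.
apply/eqP; apply: contraNT Fk => /wk <-; rewrite /cell_dim (bigD1 i) //= [in eqbRHS](bigD1 i) //=.
rewrite cell_set_in -addSn /sface_dim -GF /= prednK ?card_gt0 ?verts_neq0 //.
by apply/eqP; congr (_ + _)%N; apply: eq_bigr => j ji; rewrite cell_set_out // eq_sym.
Qed.

(* rev_ord l is the index n - l.  The cells F with F (n - l) in Delta^{j_{n-l}} x {1}
   (i.e. avoiding the cone point a i) are the coordinates of the restriction of w. *)
Definition tw_norm (l : 'I_n.+1) a (w : tw_tensor a) : \bar int :=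
  let i := rev_ord l in
  if a i == 0%N then -oo%E else
  \big[maxe/-oo%E]_(F : cell a | [forall v in verts (F i), (v < a i)%N] && (w F != 0))
    ((\sum_(j < n.+1 | (i < j)%N) sface_dim (F j))%N%:Z)%:E.

Definition tw_perverse (q : nat -> int) a (w : tw_tensor a) : bool :=
  [forall l : 'I_n.+1, (0 < l)%N ==> (tw_norm l w <= (q l)%:E)%E].

Lemma tw_perverse_lin q a c (w1 w2 : tw_tensor a) :
  tw_perverse q w1 -> tw_perverse q w2 -> tw_perverse q (c *: w1 + w2).
Proof.
move=> /forallP h1 /forallP h2; apply/forallP => l; apply/implyP => l0.
have := implyP (h1 l) l0; have := implyP (h2 l) l0; rewrite /tw_norm.
case: ifP => // _ /bigmax_leP[b0 b2] /bigmax_leP[_ b1]; apply/bigmax_leP; split=> // F.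
case/andP => Fb nz; have [w10|w1n] := eqVneq (w1 F) 0; last by apply: b1; rewrite Fb.
apply: b2; rewrite Fb; apply: contraNneq nz => w20.
by rewrite !ffunE w10 w20 scaler0 addr0.
Qed.

Lemma tw_perverse0 q a : tw_perverse q (0 : tw_tensor a).
Proof.
apply/forallP => l; apply/implyP => _; rewrite /tw_norm; case: ifP => _; first exact: leNye.
by apply/bigmax_leP; split=> [|F]; rewrite ?leNye // ffunE eqxx andbF.
Qed.

End TWTensor.

Section TWCohomology.
Variables (R : idomainType) (n : nat) (K : filtered_face_set n).

Definition reg_simplex := {s : simplex K | regular (sshape s)}.

Definition mk_reg a (s : K a) (ra : regular a) : reg_simplex :=
  exist (fun s : simplex K => regular (sshape s)) (mk_simplex s) ra.

Definition tw_family := family_mod (fun s : reg_simplex => tw_tensor R (sshape (sval s))).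

Definition tw_compatible (w : tw_family) : Prop :=
  forall a b (f : join_mor a b) (s : K b) (ra : regular a) (rb : regular b),
    w (mk_reg (restr K f s) ra) = tw_pull f (w (mk_reg s rb)) :> tw_tensor R a.

Definition family_diff (w : tw_family) : tw_family := fun s => tw_diff (w s).

Lemma family_diff_linear : linear family_diff.
Proof.
by move=> c w1 w2; apply: functional_extensionality_dep => s; rewrite /family_diff linearP.
Qed.
HB.instance Definition _ := GRing.isLinear.Build R _ _ _ family_diff family_diff_linear.

(* The bounds on the sup over s of the perverse degrees are stated pointwise. *)
Record tw_spec (q : nat -> int) (k : nat) (w : tw_family) : Prop := {
  tw_spec_compatible : tw_compatible w;
  tw_spec_degree : forall s F, w s F != 0 -> cell_dim F = k;
  tw_spec_perverse : forall s, tw_perverse q (w s);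
  tw_spec_diff_perverse : forall s, tw_perverse q (family_diff w s) }.

Lemma tw_spec_closed q k : submod_closed (fun w => `[< tw_spec q k w >]).
Proof.
split=> [|c w1 w2]; rewrite !unfold_in.
  apply/asboolP; split=> [a b f s ra rb|s F|s|s].
  - by apply/ffunP => F; rewrite !ffunE.
  - by rewrite ffunE eqxx.
  - exact: tw_perverse0.
  - by rewrite linear0; exact: tw_perverse0.
move=> /asboolP[h1 h2 h3 h4] /asboolP[g1 g2 g3 g4]; apply/asboolP; split=> [a b f s ra rb|s F|s|s].
- by rewrite !family_linE (h1 _ _ _ _ _ rb) (g1 _ _ _ _ _ rb); apply/ffunP => F; rewrite !ffunE.
- rewrite family_linE !ffunE => nz; have [w10|/h2//] := eqVneq (w1 s F) 0.
  by apply: (g2 s F); apply: contraNneq nz => ->; rewrite w10 scaler0 addr0.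
- by rewrite family_linE; exact: tw_perverse_lin.
- by rewrite linearP family_linE; exact: tw_perverse_lin.
Qed.

Definition tw_cochain q k := submod (Submodule (tw_spec_closed q k)).

Lemma tw_coboundary_subproof q k (w : tw_cochain q k) :
  family_diff (val w) \in spred (Submodule (tw_spec_closed q k.+1)).
Proof.
have /asboolP[h1 h2 h3 h4] := submodP w; apply/asboolP; split=> [a b f s ra rb|s||s] //.
- exact: etrans (congr1 (@tw_diff R n a) (h1 _ _ f s ra rb)) (tw_pull_diff f _).
- by apply: tw_diff_homog => F; exact: h2.
- by rewrite /family_diff tw_diff2; exact: tw_perverse0.
Qed.

Definition tw_coboundary q k (w : tw_cochain q k) : tw_cochain q k.+1 :=
  Submod (tw_coboundary_subproof w).

Lemma tw_coboundary_linear q k : linear (@tw_coboundary q k).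
Proof. by move=> c w1 w2; apply: val_inj; rewrite /= linearP. Qed.
HB.instance Definition _ q k := GRing.isLinear.Build R _ _ _ (@tw_coboundary q k)
  (@tw_coboundary_linear q k).

Lemma tw_coboundary2 q k (w : tw_cochain q k) : tw_coboundary (tw_coboundary w) = 0.
Proof.
by apply: val_inj; apply: functional_extensionality_dep => s; exact: tw_diff2.
Qed.

Definition tw_complex q : cochain_complex R :=
  @CochainComplex R (fun k => tw_cochain q k) (fun k => @tw_coboundary q k)
    (@tw_coboundary2 q).

End TWCohomology.

Definition H_TW (R : idomainType) n (q : nat -> int) (K : filtered_face_set n) (k : nat) :
  lmodType R := cohomology (tw_complex R K q) k.

Definition H_GM (R : idomainType) n (p : nat -> int) (K : filtered_face_set n) (k : nat) :
  lmodType R := cohomology (dual_complex (gm_chain_complex R K p)) k.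

(* Ordinary cohomology of the underlying face set, whose k-simplices are all the
   simplices of K of dimension k. *)
Definition H_simp (R : idomainType) n (K : filtered_face_set n) (k : nat) :
  lmodType R := cohomology (dual_complex (simplicial_chain_complex R K)) k.

Definition zero_perversity : nat -> int := fun=> 0.
Definition tprime_perversity : nat -> int := fun i => if i == 0%N then 0 else i%:Z - 2%:Z.

(* Main.v *)
From HB Require Import structures.
Require Import Defs.
From mathcomp Require Import all_boot all_order all_algebra.
From mathcomp Require Import boolp constructive_ereal freeg zify.

(* For q = 0 the tensor w_s must vanish on the cells F = (F_0, ..., F_n) of the
   blow-up such that some F_i misses the cone point while a later F_j has positive
   dimension, and so must its differential.  Hence w_s is a cochain on the quotient
   of the blow-up in which, as soon as F_i misses the cone point, the later factors
   are collapsed.  The cells of that quotient are exactly the faces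
   G_0 * ... * G_i of the simplex, where F_k is the cone on G_k for k < i and
   F_i = G_i.  In a normal K every simplex lies in a regular one, and any two regular
   simplices containing it are linked by a zigzag, so the families (w_s) are exactly
   the cochains of K: the TW complex is isomorphic to the simplicial one.

   A simplex is t'-admissible iff it has no singular vertex or has at least two
   vertices in the last factor.  The other simplices are tau and tau * v, with tau
   singular.  The link of tau is non-empty and connected: choosing in it a vertex v0
   and a path from v0 to each v defines h(tau) = +-tau * v0 and h(tau * v) = +-tau * path.
   Then 1 - dh - hd is the identity on GM-chains, and it lowers the number of singular
   vertices of the inadmissible simplices; its iterates retract simplicial chains onto
   GM-chains. *)

Set Implicit Arguments.
Unset Strict Implicit.
Unset Printing Implicit Defensive.

Import Order.TTheory GRing.Theory Num.Theory.
Local Open Scope ring_scope.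

Definition mk_linear (R : pzRingType) (U V : lmodType R) (f : U -> V) (fl : linear f) :
  {linear U -> V} := HB.pack f (GRing.isLinear.Build R U V _ f fl).

Lemma injective_surjective_bijective (A B : Type) (f : A -> B) :
  injective f -> (forall y, exists x, f x = y) -> bijective f.
Proof.
move=> fi fs; pose g y := projT1 (cid (fs y)).
have fgK y : f (g y) = y by rewrite /g; case: cid.
by exists g => // x; apply: fi.
Qed.

(** * Quasi-isomorphisms *)

Section LmodIso.
Variable R : pzRingType.
Implicit Types U V W : lmodType R.

Lemma lmod_iso_sym U V : lmod_iso U V -> lmod_iso V U.
Proof.
move=> [f [g fK gK]]; have gl : linear g.
  by move=> a x y; apply: (can_inj fK); rewrite linearP !gK.
by exists (mk_linear gl); exists f.
Qed.

Lemma lmod_iso_trans U V W : lmod_iso U V -> lmod_iso V W -> lmod_iso U W.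
Proof. by move=> [f fb] [g gb]; exists (g \o f); exact: bij_comp. Qed.

Variables (C D : cochain_complex R) (phi : forall k, {linear C k -> D k}).
Hypothesis phid : forall k x, phi k.+1 (coboundary C k x) = coboundary D k (phi k x).
Variable k : nat.
Hypothesis phi_inj : forall x : C k,
  coboundary C k x = 0 -> is_coboundary (phi k x) -> is_coboundary x.
Hypothesis phi_surj : forall y : D k, coboundary D k y = 0 ->
  exists2 x : C k, coboundary C k x = 0 & is_coboundary (phi k x - y).

Lemma phi_cocycle (x : cocycle C k) :
  phi k (val x) \in spred (Submodule (@cocycle_closed R D k)).
Proof.
have /eqP h := submodP x.
by apply/eqP; rewrite -phid h linear0.
Qed.

Lemma phi_coboundary (x : C k) : is_coboundary x -> is_coboundary (phi k x).
Proof.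
rewrite /is_coboundary; case: k x => [x ->|k' x [y ->]]; first exact: linear0.
by exists (phi k' y); rewrite phid.
Qed.

Definition cohomology_map (x : cohomology C k) : cohomology D k :=
  quotmod_pi _ (Submod (phi_cocycle (quotmod_repr x))).

(** [cohomology_map] is defined through a chosen representative. The choice is harmless because two
    representatives differ by a coboundary, which [phi] sends to a coboundary. *)
Lemma cohomology_mapE (x : cocycle C k) :
  cohomology_map (quotmod_pi _ x) = quotmod_pi _ (Submod (phi_cocycle x)).
Proof.
apply/eqP; rewrite quotmod_eq; apply/asboolP => /=.
rewrite -linearB; apply: phi_coboundary.
set y := quotmod_repr _.
have : quotmod_pi (Submodule (@coboundary_closed R C k)) y == quotmod_pi _ x.
  by rewrite /y quotmod_reprK.
by rewrite quotmod_eq => /asboolP.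
Qed.

Lemma cohomology_map_linear : linear cohomology_map.
Proof.
move=> a x y; rewrite -[x]quotmod_reprK -[y]quotmod_reprK.
rewrite -(quotmod_pi_linear (Submodule (@coboundary_closed R C k))) !cohomology_mapE.
rewrite -(quotmod_pi_linear (Submodule (@coboundary_closed R D k))).
by congr (quotmod_pi _ _); apply: val_inj; rewrite /= linearP.
Qed.

Lemma quasi_iso_lmod_iso : lmod_iso (cohomology C k) (cohomology D k).
Proof.
exists (mk_linear cohomology_map_linear); apply: injective_surjective_bijective => /=.
  move=> x y; rewrite -[x]quotmod_reprK -[y]quotmod_reprK !cohomology_mapE.
  move=> /eqP; rewrite quotmod_eq => /asboolP /=; rewrite -linearB => h.
  apply/eqP; rewrite quotmod_eq; apply/asboolP; apply: phi_inj => //.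
  exact/eqP/(submodP (quotmod_repr x - quotmod_repr y)).
move=> y; rewrite -[y]quotmod_reprK; set z := quotmod_repr y.
have /eqP zc := submodP z.
have [x xc xz] := phi_surj zc.
have xs : x \in spred (Submodule (@cocycle_closed R C k)) by apply/eqP.
exists (quotmod_pi _ (Submod xs)); rewrite cohomology_mapE.
by apply/eqP; rewrite quotmod_eq; apply/asboolP.
Qed.

End LmodIso.

(** * Free modules and subsimplices *)

Section FreeModules.
Variables (R : idomainType) (T : choiceType).
Local Notation chains := {freeg T / R}.

Definition free_lift (M : lmodType R) (f : T -> M) : {linear chains -> M} :=
  mk_linear (fglift_linear f).

Lemma free_liftU (M : lmodType R) (f : T -> M) x : free_lift f << x >> = f x.
Proof. by rewrite /= liftU scale1r. Qed.

Lemma free_sum (c : chains) : c = \sum_(x <- dom c) coeff x c *: << x >>.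
Proof.
rewrite -[LHS]freeg_sumE; apply: eq_bigr => x _.
by apply/eqP/freeg_eqP => y; rewrite coeffZ !coeffU mul1r.
Qed.

Lemma eq_free (M : lmodType R) (f g : {linear chains -> M}) (c : chains) :
  {in dom c, forall x, f << x >> = g << x >>} -> f c = g c.
Proof.
move=> e; rewrite [c]free_sum !linear_sum; apply: eq_big_seq => x xc.
by rewrite !linearZ e.
Qed.

Lemma free_lift_eq0 (M : lmodType R) (g : T -> M) (c : chains) :
  {in dom c, forall x, g x = 0} -> free_lift g c = 0.
Proof. by move=> g0; apply: (eq_free (g := \0)) => x xc; rewrite /= liftU g0 // scaler0. Qed.

Lemma free_lift_lin (M : lmodType R) (f g : T -> M) a (c : chains) :
  free_lift (fun x => a *: f x + g x) c = a *: free_lift f c + free_lift g c.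
Proof.
rewrite [c]free_sum !linear_sum -big_split; apply: eq_bigr => x _.
have fZ h : free_lift h (coeff x c *: << x >>) = coeff x c *: h x :> M.
  by rewrite linearZ free_liftU.
by rewrite !fZ /= scalerDr !scalerA mulrC.
Qed.

Implicit Types P Q : pred T.

Lemma supp_add P (c e : chains) : all P (dom c) -> all P (dom e) -> all P (dom (c + e)).
Proof.
by move=> /allP hc /allP he; apply/allP => s /domD_subset; rewrite mem_cat => /orP[/hc|/he].
Qed.

Lemma supp_scale P a (c : chains) : all P (dom c) -> all P (dom (a *: c)).
Proof. by move=> /allP hc; apply/allP => s /domZ_subset/hc. Qed.

Lemma supp_opp P (c : chains) : all P (dom c) -> all P (dom (- c)).
Proof. by move=> h; rewrite -scaleN1r supp_scale. Qed.

Lemma supp_sub P (c e : chains) : all P (dom c) -> all P (dom e) -> all P (dom (c - e)).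
Proof. by move=> hc he; rewrite supp_add ?supp_opp. Qed.

Lemma supp_sum I (r : seq I) (S : pred I) P (F : I -> chains) :
  (forall i, S i -> all P (dom (F i))) -> all P (dom (\sum_(i <- r | S i) F i)).
Proof.
move=> h; apply: (big_ind (fun c : chains => all P (dom c))) => //; first by rewrite dom0.
exact: supp_add.
Qed.

Lemma suppW P Q (c : chains) : subpred P Q -> all P (dom c) -> all Q (dom c).
Proof. by move=> PQ; apply: sub_all. Qed.

End FreeModules.

(** Throughout, [all P (dom c)] says that c is a combination of generators satisfying P. This lemma
    reduces support estimates for linear maps to generators. *)
Lemma supp_lin (R : idomainType) (T T' : choiceType)
    (f : {linear {freeg T / R} -> {freeg T' / R}}) (P : pred T) (Q : pred T') (c : {freeg T / R}) :
  (forall x, P x -> all Q (dom (f << x >>))) -> all P (dom c) -> all Q (dom (f c)).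
Proof.
move=> h /allP cP; rewrite [c]free_sum linear_sum big_seq; apply: supp_sum => x /cP Px.
by rewrite linearZ supp_scale ?h.
Qed.

(** * Increasing maps between finite ordinals *)

Section IncreasingMaps.

Lemma increasing_lt p m (f : 'I_p -> 'I_m) : (forall x y : 'I_p, (x < y)%N -> (f x < f y)%N) ->
  forall x y : 'I_p, (f x < f y)%N = (x < y)%N.
Proof.
move=> fm x y; case: (ltngtP x y) => [/fm //|/fm|/val_inj->]; last by rewrite ltnn.
by move/ltnW; rewrite leqNgt => /negPf.
Qed.

Lemma increasing_inj p m (f : 'I_p -> 'I_m) : (forall x y : 'I_p, (x < y)%N -> (f x < f y)%N) ->
  injective f.
Proof.
move=> /increasing_lt fm x y e; apply/val_inj; case: (ltngtP x y) => //.
  by rewrite -fm e ltnn.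
by rewrite -fm e ltnn.
Qed.

Lemma card_ord_lt p k : (k <= p)%N -> #|[set y : 'I_p | (y < k)%N]| = k.
Proof.
move=> kp; rewrite -sum1dep_card.
by rewrite -(big_ord_widen p (fun=> 1%N) kp) sum1_card card_ord.
Qed.

Lemma increasing_rank p m (f : 'I_p -> 'I_m) (x : 'I_p) :
  (forall x y : 'I_p, (x < y)%N -> (f x < f y)%N) ->
  #|[set u in f @: setT | (u < f x)%N]| = x.
Proof.
move=> fm; have fi := increasing_inj fm.
rewrite (_ : [set u in _ | _] = f @: [set y : 'I_p | (y < x)%N]).
  by rewrite card_imset // card_ord_lt // ltnW.
apply/setP => u; rewrite inE; apply/andP/imsetP => [[/imsetP[y _ ->]]|[y]].
  by rewrite increasing_lt // => yx; exists y; rewrite ?inE.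
by rewrite inE => yx ->; rewrite increasing_lt ?imset_f ?inE.
Qed.

(** An increasing map is determined by its image, since x is the rank of [f x] in it. Arguments are
    compared by value, so that no equality between p and q has to be transported. *)
Lemma increasing_eq p q m (f : 'I_p -> 'I_m) (g : 'I_q -> 'I_m) :
  (forall x y : 'I_p, (x < y)%N -> (f x < f y)%N) ->
  (forall x y : 'I_q, (x < y)%N -> (g x < g y)%N) ->
  f @: setT = g @: setT -> forall (x : 'I_p) (y : 'I_q), x = y :> nat -> f x = g y.
Proof.
move=> fm gm e x y xy; have : f x \in g @: setT by rewrite -e imset_f ?inE.
move=> /imsetP[z _ fz]; rewrite fz; congr (g _); apply: val_inj; rewrite /= -xy.
by rewrite -(increasing_rank x fm) -(increasing_rank z gm) -fz e.
Qed.

Lemma enum_val_increasing m (A : {set 'I_m}) (x y : 'I_#|A|) :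
  (x < y)%N -> (enum_val x < enum_val y)%N.
Proof.
have s : sorted ltn (map val (enum A)).
  apply: (subseq_sorted (leT := ltn)) (iota_ltn_sorted 0 m); first exact: ltn_trans.
  by rewrite -val_enum_ord map_subseq // enumT filter_subseq.
have x0 : 'I_m := enum_val x; move=> xy; rewrite !(enum_val_nth x0).
rewrite -[X in (X < _)%N](nth_map x0 0%N val) -?cardE //.
rewrite -[X in (_ < X)%N](nth_map x0 0%N val) -?cardE //.
by apply: (sorted_ltn_nth ltn_trans) => //; rewrite ?inE size_map -cardE.
Qed.

End IncreasingMaps.

(** * Faces of a simplex as families of vertex sets *)

Section Subsimplices.
Variables (n : nat).
Implicit Types (a b : join_shape n).

(** One vertex set per factor: this encodes a face of the join by its vertices, the empty face
    included, and lets faces of different shapes be compared inside one simplex. *)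
Definition vfamily b := forall i, {set 'I_(b i)}.

Definition image_family a b (f : join_mor a b) (A : vfamily a) : vfamily b :=
  fun i => f i @: A i.

Definition full_family b : vfamily b := fun i => setT.

Definition remove b (A : vfamily b) l (v : 'I_(b l)) : vfamily b := dfwith A (A l :\ v).

Lemma remove_in b (A : vfamily b) l (v : 'I_(b l)) : remove A v l = A l :\ v.
Proof. exact: dfwith_in. Qed.

Lemma remove_out b (A : vfamily b) l (v : 'I_(b l)) i : l != i -> remove A v i = A i.
Proof. exact: dfwith_out. Qed.

Lemma vfamilyP b (A B : vfamily b) : (forall i, A i = B i) -> A = B.
Proof. by move=> e; apply: functional_extensionality_dep. Qed.

Section SubMor.
Variables (b : join_shape n) (A : vfamily b).
Hypothesis A0 : (0 < \sum_i #|A i|)%N.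

Lemma sub_shape_subproof : (0 < \sum_i [ffun i => #|A i|] i)%N.
Proof. by under eq_bigr do rewrite ffunE. Qed.

Definition sub_shape : join_shape n := JoinShape sub_shape_subproof.

Definition sub_mor : join_mor sub_shape b :=
  @JoinMor n sub_shape b (fun i x => enum_val (cast_ord (ffunE _ i) x))
    (fun i x y xy => enum_val_increasing (xy : (cast_ord (ffunE _ i) x < cast_ord (ffunE _ i) y)%N)).

Lemma sub_shapeE i : sub_shape i = #|A i|. Proof. by rewrite /= ffunE. Qed.

Lemma image_sub_mor : image_family sub_mor (@full_family _) = A.
Proof.
apply: vfamilyP => i; apply/setP => v; apply/imsetP/idP => [[x _ ->]|vA]; first exact: enum_valP.
exists (cast_ord (esym (ffunE _ i)) (enum_rank_in vA v)); first by rewrite inE.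
by rewrite -[LHS](enum_rankK_in vA vA); congr enum_val; apply: val_inj.
Qed.

End SubMor.

Variable (K : filtered_face_set n).
Implicit Types (s : simplex K).

Lemma card_image_family a b (f : join_mor a b) (A : vfamily a) i : #|image_family f A i| = #|A i|.
Proof. by rewrite card_imset //; exact: join_mor_inj. Qed.

Lemma card_full b i : #|full_family b i| = b i.
Proof. by rewrite cardsT card_ord. Qed.

(** A face inclusion is increasing on each factor, hence determined by its image. *)
Lemma restr_image a a' s (f : join_mor a (sshape s)) (f' : join_mor a' (sshape s)) :
  image_family f (@full_family a) = image_family f' (@full_family a') ->
  mk_simplex (restr K f (tagged s)) = mk_simplex (restr K f' (tagged s)).
Proof.
move=> e; apply: mk_simplex_eq => i.
  by rewrite -[LHS]card_full -[RHS]card_full -(card_image_family f) e card_image_family.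
move=> x x' xx; congr val; apply: increasing_eq xx.
- exact: join_funP.
- exact: join_funP.
- exact: (congr1 (fun A : vfamily (sshape s) => A i) e).
Qed.

Definition sub_simplex s (A : vfamily (sshape s)) (A0 : (0 < \sum_i #|A i|)%N) : simplex K :=
  mk_simplex (restr K (sub_mor A0) (tagged s)).

Lemma image_full_gt0 a b (f : join_mor a b) :
  (0 < \sum_i #|image_family f (@full_family a) i|)%N.
Proof. by under eq_bigr do rewrite card_image_family card_full; exact: nverts_gt0. Qed.

Lemma restr_sub a s (f : join_mor a (sshape s)) :
  mk_simplex (restr K f (tagged s)) = sub_simplex (image_full_gt0 f).
Proof. by apply: restr_image; rewrite image_sub_mor. Qed.

Lemma restr_incl s t (f : face_incl s t) : s = sub_simplex (image_full_gt0 f).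
Proof. by rewrite -restr_sub inclP; case: s f. Qed.

Lemma sub_restr a s (f : join_mor a (sshape s)) (A : vfamily a) (A0 : (0 < \sum_i #|A i|)%N)
   (B0 : (0 < \sum_i #|image_family f A i|)%N) :
  @sub_simplex (mk_simplex (restr K f (tagged s))) A A0 = sub_simplex B0.
Proof.
rewrite /sub_simplex /= -restr_comp; apply: restr_image; rewrite image_sub_mor.
rewrite -[in RHS](image_sub_mor A0); apply: vfamilyP => i.
by rewrite /image_family -imset_comp.
Qed.

Variable R : idomainType.
Local Notation chains := {freeg (simplex K) / R}.

(* The empty family gives the chain 0, so that the boundary formula below also holds
   for vertices. *)
Definition sub_chain s (A : vfamily (sshape s)) : chains :=
  if (0 < \sum_i #|A i|)%N =P true is ReflectT A0 then << sub_simplex A0 >> else 0.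

Lemma sub_chainE s (A : vfamily (sshape s)) (A0 : (0 < \sum_i #|A i|)%N) :
  sub_chain A = << sub_simplex A0 >>.
Proof. by rewrite /sub_chain; case: eqP => // A1; rewrite (bool_irrelevance A0 A1). Qed.

Lemma sub_chain0 s (A : vfamily (sshape s)) : (forall i, A i = set0) -> sub_chain A = 0.
Proof.
move=> A0; rewrite /sub_chain; case: eqP => // h; exfalso; move: h.
by rewrite big1 // => i _; rewrite A0 cards0.
Qed.

Lemma sub_chain_restr a s (f : join_mor a (sshape s)) (A : vfamily a) :
  @sub_chain (mk_simplex (restr K f (tagged s))) A = sub_chain (image_family f A).
Proof.
rewrite /sub_chain; case: eqP => A0; case: eqP => B0 //.
- by rewrite (sub_restr A0 B0).
- by case: B0; under eq_bigr do rewrite card_image_family.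
- by case: A0; move: B0; under eq_bigr do rewrite card_image_family.
Qed.

Lemma sub_chain_full s : sub_chain (@full_family (sshape s)) = << s >>.
Proof.
have A0 : (0 < \sum_i #|@full_family (sshape s) i|)%N.
  by under eq_bigr do rewrite card_full; exact: nverts_gt0.
rewrite (sub_chainE A0); congr << _ >>; rewrite /sub_simplex.
rewrite (@restr_image _ _ s (sub_mor A0) (join_id (sshape s))).
  by rewrite restr_id; case: s {A0}.
rewrite image_sub_mor; apply: vfamilyP => i.
by apply/setP => x; rewrite !inE; apply/esym/imsetP; exists x.
Qed.

Lemma boundary_full s : chain_boundary (<< s >> : chains) =
  \sum_l \sum_(x < sshape s l) (-1) ^+ vertex_pos (sshape s) l x *:
     sub_chain (remove (@full_family (sshape s)) x).
Proof.
rewrite chain_boundaryU.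
have E l (x : 'I_(sshape s l)) i : (#|remove (@full_family (sshape s)) x i| = face_verts (sshape s) l i)%N.
  rewrite ffunE; have [<-|il] := eqVneq l i.
    have := cardsD1 x (@full_family (sshape s) l).
    by rewrite remove_in card_full in_setT subn1 => /(congr1 predn) ->.
  by rewrite remove_out // card_full subn0.
(* For a single vertex both sides vanish: the family left after removing it is empty and [sub_chain]
   sends it to 0. *)
case: (boolP (1 < nvert (sshape s))%N) => s1; last first.
  rewrite simplex_boundary0 // big1 // => l _; rewrite big1 // => x _.
  have S0 : (\sum_i #|remove (@full_family (sshape s)) x i| = 0)%N.
    under eq_bigr do rewrite E.
    by have := sum_face_verts (vertex_gt0 x); move: s1; rewrite /nvert; lia.
  rewrite sub_chain0 ?scaler0 // => i; apply/eqP; rewrite -cards_eq0.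
  by move/eqP: S0; rewrite sum_nat_eq0 => /forallP /(_ i).
rewrite (simplex_boundaryE _ s1); apply: eq_bigr => l _; apply: eq_bigr => x _; congr (_ *: _).
have A0 : (0 < \sum_i #|remove (@full_family (sshape s)) x i|)%N.
  by under eq_bigr do rewrite E; exact: face_verts_gt0 (vertex_gt0 x) s1.
rewrite (sub_chainE A0); congr << _ >>; apply: restr_image; rewrite image_sub_mor.
apply: vfamilyP => i; apply/setP => v; have [il|il] := eqVneq l i.
  subst i; rewrite remove_in !inE andbT; apply/imsetP/idP => [[y _ ->]|vx].
    by rewrite -val_eqE /= /face_fun eqxx eq_sym neq_bump.
  (* [unbump x v] is the index of v among the vertices of the factor once x is deleted. *)
  have ux : (unbump x v < face_shape (vertex_gt0 x) s1 l)%N.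
    rewrite /= ffunE eqxx /unbump; move: vx (ltn_ord v) (ltn_ord x).
    by rewrite -val_eqE /=; case: ltngtP => //=; lia.
  exists (Ordinal ux) => //; apply: val_inj; rewrite /= /face_fun eqxx unbumpKcond.
  by rewrite val_eqE (negPf vx).
rewrite remove_out // inE; apply/imsetP.
have ux : (v < face_shape (vertex_gt0 x) s1 i)%N.
  by rewrite /= ffunE eq_sym (negPf il) subn0.
by exists (Ordinal ux) => //; apply: val_inj; rewrite /= /face_fun eq_sym (negPf il).
Qed.

(** This is [boundary_full] transported along [sub_mor]; the exponent counts the vertices of A that
    precede v in the order of the join. *)
Lemma boundary_sub_chain s (A : vfamily (sshape s)) : chain_boundary (sub_chain A) =
  \sum_l \sum_(v in A l)
    (-1) ^+ (\sum_(i < n.+1 | (i < l)%N) #|A i| + #|[set u in A l | (u < v)%N]|)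
     *: sub_chain (remove A v).
Proof.
case: (boolP (0 < \sum_i #|A i|)%N) => A0; last first.
  have Ai i : A i = set0.
    apply/eqP; rewrite -cards_eq0.
    by move: A0; rewrite -eqn0Ngt sum_nat_eq0 => /forallP /(_ i).
  rewrite sub_chain0 // linear0 big1 // => l _.
  by rewrite big1 // => v; rewrite Ai inE.
rewrite (sub_chainE A0) boundary_full; apply: eq_bigr => l _.
pose f x := sub_mor A0 l x.
have fm (x y : 'I_(sub_shape A0 l)) : (x < y)%N -> (f x < f y)%N by exact: join_funP.
have fA : f @: setT = A l by exact: (congr1 (fun B : vfamily (sshape s) => B l) (image_sub_mor A0)).
rewrite -[in RHS]fA big_imset /=; last by move=> x y _ _; exact: increasing_inj.
apply: eq_big => [x|x _]; first by rewrite inE.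
rewrite increasing_rank // /vertex_pos.
congr ((-1) ^+ (_ + _) *: _); first by apply: eq_bigr => i _; rewrite ffunE.
rewrite sub_chain_restr; congr (sub_chain _); apply: vfamilyP => i.
have [<-|il] := eqVneq l i; rewrite ?remove_in ?remove_out //.
  rewrite /image_family remove_in -fA; apply/setP => u; rewrite !inE.
  apply/imsetP/andP => [[y]|[ux /imsetP[y _ uy]]].
    rewrite !inE andbT => yx ->; rewrite imset_f ?inE ?(inj_eq (increasing_inj fm)) //.
  by exists y => //; rewrite !inE andbT; apply: contraNneq ux => <-; rewrite uy.
rewrite /image_family remove_out //.
exact: (congr1 (fun B : vfamily (sshape s) => B i) (image_sub_mor A0)).
Qed.

End Subsimplices.

(** * Simplicial cochains as functions on simplices *)

Section Functionals.
Variables (R : idomainType) (n : nat) (K : filtered_face_set n).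
Local Notation simplex := (simplex K).
Local Notation chains := {freeg simplex / R}.
Local Notation cochains := (dual_complex (simplicial_chain_complex R K)).

Lemma unit_supported k (s : simplex) : sdim s == k ->
  << s >> \in spred (Submodule (@supported_closed R n K predT k)).
Proof. by move=> sk; apply/and3P; split; rewrite ?all_predT // domU1 /= sk. Qed.

Definition unit_chain k (s : simplex) : supported_chain R predT k :=
  if (sdim s == k) =P true is ReflectT sk then Submod (unit_supported sk) else 0.

Lemma unit_chainE k s : sdim s == k -> val (unit_chain k s) = << s >>.
Proof. by rewrite /unit_chain; case: eqP. Qed.

Lemma unit_chain0 k s : sdim s != k -> unit_chain k s = 0.
Proof. by move=> /negP sk; rewrite /unit_chain; case: eqP. Qed.

Definition dim_proj k : {linear chains -> supported_chain R predT k} := free_lift (@unit_chain k).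

Lemma dim_projK k (c : supported_chain R predT k) : dim_proj k (val c) = c.
Proof.
apply: val_inj; have vl : linear (fun c : chains => val (dim_proj k c)).
  by move=> a x y; rewrite !linearP.
apply: (eq_free (f := mk_linear vl) (g := idfun)) => s sc /=.
have /and3P[/allP ck _ _] := submodP c.
by rewrite liftU scale1r unit_chainE ?ck.
Qed.

(** A k-cochain seen as a function on all simplices, zero outside dimension k. It can then be
    evaluated on arbitrary chains by [free_lift]. *)
Definition values k (f : cochains k) (s : simplex) : R^o := f (unit_chain k s).

Lemma values_lift k (f : cochains k) c : free_lift (values f) c = f (dim_proj k c).
Proof.
apply: (eq_free (g := f \o dim_proj k)) => s _.
by rewrite /= !liftU !scale1r.
Qed.

Lemma values_liftE k (f : cochains k) c : f c = free_lift (values f) (val c).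
Proof. by rewrite values_lift dim_projK. Qed.

Lemma values0 k (f : cochains k) s : sdim s != k -> values f s = 0.
Proof. by move=> sk; rewrite /values unit_chain0 ?linear0. Qed.

Lemma dim_boundary (s : simplex) :
  all (fun t => (sdim t).+1 == sdim s) (dom (chain_boundary (<< s >> : chains))).
Proof.
case E : (sdim s) => [|m].
  by rewrite chain_boundaryU simplex_boundary0 ?dom0 //; move: E; rewrite /sdim /join_dim; lia.
by apply: dom_chain_boundary; rewrite domU1 /= E eqxx.
Qed.

Lemma values_coboundary k (f : cochains k) s :
  values (coboundary cochains k f) s = free_lift (values f) (chain_boundary << s >>).
Proof.
have [sk|sk] := boolP (sdim s == k.+1).
  by rewrite {1}/values /= [LHS]values_liftE /= unit_chainE.
rewrite values0 // free_lift_eq0 // => t /(allP (dim_boundary s)) /eqP ts.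
by apply: values0; apply: contraNneq sk => <-; rewrite ts.
Qed.

Lemma cochain_of_values k (g : simplex -> R^o) : (forall s, sdim s != k -> g s = 0) ->
  exists f : cochains k, values f = g.
Proof.
move=> g0; have gl : linear (fun c : supported_chain R predT k => free_lift g (val c)).
  by move=> a x y; rewrite !linearP.
exists (mk_linear gl); apply/funext => s; rewrite /values /=.
have [sk|sk] := boolP (sdim s == k); first by rewrite unit_chainE // liftU scale1r.
by rewrite unit_chain0 //= raddf0 g0.
Qed.

Lemma values_inj k : injective (@values k).
Proof. by move=> f g e; apply: hom_eqP => c; rewrite !values_liftE e. Qed.

End Functionals.

(** * Cells of the blow-up *)

Section Cells.
Variables (n : nat).
Implicit Types (a b : join_shape n).

(** The cone point of factor i is the vertex of value [b i]. The last factor is not coned, so that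
    the predicate is false there. *)
Definition has_cone b (F : cell b) i := [exists v in verts (F i), (b i <= v)%N].

Definition bad_cell b (F : cell b) :=
  [exists i : 'I_n.+1, exists j : 'I_n.+1, [&& (i < j)%N, ~~ has_cone F i & (0 < sface_dim (F j))%N]].

Lemma bad_cellI b (F : cell b) (i j : 'I_n.+1) :
  (i < j)%N -> ~~ has_cone F i -> (0 < sface_dim (F j))%N -> bad_cell F.
Proof. by move=> ij Fi Fj; apply/existsP; exists i; apply/existsP; exists j; rewrite ij Fi. Qed.

Lemma bad_cellP b (F : cell b) : bad_cell F ->
  exists i j : 'I_n.+1, [/\ (i < j)%N, ~~ has_cone F i & (0 < sface_dim (F j))%N].
Proof. by move=> /existsP[i /existsP[j /and3P[*]]]; exists i, j. Qed.

Lemma good_cellP b (F : cell b) (i j : 'I_n.+1) :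
  ~~ bad_cell F -> (i < j)%N -> ~~ has_cone F i -> sface_dim (F j) = 0%N.
Proof.
by move=> Fg ij Fi; apply/eqP; rewrite eqn0Ngt; apply: contra Fg; exact: bad_cellI ij Fi.
Qed.

Lemma has_cone_max b (F : cell b) : ~~ has_cone F ord_max.
Proof.
apply/existsP => -[v /andP[_]]; rewrite leqNgt => /negP; apply.
by move: (ltn_ord v); rewrite {2}/cone_nverts eqxx addn0.
Qed.

Definition base_vertex b i (v : 'I_(b i)) : 'I_(cone_nverts b i) := lshift _ v.

Lemma base_vertex_inj b i : injective (@base_vertex b i).
Proof. exact: lshift_inj. Qed.

(** The live indices form an initial segment ending at the first factor without cone point. That
    factor exists because the last one never has a cone point, see [first_coneless]. *)
Definition live b (F : cell b) (i : 'I_n.+1) := [forall j : 'I_n.+1, (j < i)%N ==> has_cone F j].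

Lemma liveP b (F : cell b) (i : 'I_n.+1) :
  reflect (forall j : 'I_n.+1, (j < i)%N -> has_cone F j) (live F i).
Proof. exact: 'forall_implyP. Qed.

(* The face G_0 * ... * G_i onto which the cell F is collapsed, i being the first
   index at which the cone point is missing. *)
Definition base b (F : cell b) : vfamily b :=
  fun i => [set v | live F i && (base_vertex v \in verts (F i))].

Lemma first_coneless b (F : cell b) : exists t : 'I_n.+1,
  ~~ has_cone F t /\ forall i, live F i = (i <= t)%N.
Proof.
case: (@arg_minnP _ ord_max (fun i => ~~ has_cone F i) val (has_cone_max F)) => t Ft tmin.
exists t; split=> // i; apply/liveP/idP => [h|it j ji].
  by rewrite leqNgt; apply: contra Ft => /h.
by apply: contraTT (leq_trans ji it) => /tmin; rewrite -leqNgt.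
Qed.

Lemma sface_dim0 m (F : sface m) : (sface_dim F == 0%N) = (#|F| == 1%N).
Proof.
by rewrite /sface_dim; have := verts_neq0 F; rewrite -card_gt0; case: #|_| => [|[|]].
Qed.

Lemma sface_card m (F : sface m) : #|F| = (sface_dim F).+1.
Proof. by rewrite /sface_dim prednK // card_gt0 verts_neq0. Qed.

Lemma eq_has_cone b (F F' : cell b) i : F i = F' i -> has_cone F i = has_cone F' i.
Proof. by rewrite /has_cone => ->. Qed.

(** Factor j lies behind the coneless factor i, so it is not live and its vertices do not enter the
    base. If j is the coneless factor that witnesses badness, i can replace it. *)
Lemma eq_bad_base b (F F' : cell b) (i j : 'I_n.+1) :
  (i < j)%N -> ~~ has_cone F i -> (forall l, l != j -> F l = F' l) ->
  sface_dim (F j) = sface_dim (F' j) ->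
  bad_cell F = bad_cell F' /\ base F = base F'.
Proof.
move=> ij Fi e ej; have ji : i != j by apply: contraTneq ij => ->; rewrite ltnn.
have dE l : sface_dim (F l) = sface_dim (F' l) by have [->|/e->] := eqVneq l j.
have F'i : ~~ has_cone F' i by rewrite -(eq_has_cone (e _ ji)).
split.
  apply/idP/idP => /bad_cellP[p [q [pq Fp Fq]]].
  - have [pj|/e/eq_has_cone pj] := eqVneq p j.
      by subst p; apply: (bad_cellI (ltn_trans ij pq) F'i); rewrite -dE.
    by apply: (bad_cellI pq); rewrite -?pj -?dE.
  - have [pj|/e/eq_has_cone pj] := eqVneq p j.
      by subst p; apply: (bad_cellI (ltn_trans ij pq) Fi); rewrite dE.
    by apply: (bad_cellI pq); rewrite ?pj ?dE.
have lE l : live F l = live F' l.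
  apply/liveP/liveP => h p pl; have := h p pl; have [pj|/e/eq_has_cone->//] := eqVneq p j.
    by subst p; move: (h i (ltn_trans ij pl)); rewrite (negPf Fi).
  by subst p; move: (h i (ltn_trans ij pl)); rewrite (negPf F'i).
apply: vfamilyP => l; apply/setP => v; rewrite !inE lE; have [lj|/e->//] := eqVneq l j.
subst l; suff -> : live F' j = false by [].
by apply/liveP => /(_ i ij); rewrite (negPf F'i).
Qed.

End Cells.

(** * Behaviour of cells under face inclusions *)

Section Pull.
Variables (n : nat).
Implicit Types (a b : join_shape n).

Lemma cone_map_base a b (f : join_mor a b) i (v : 'I_(a i)) :
  cone_map f (base_vertex v) = base_vertex (f i v).
Proof. by rewrite /cone_map /base_vertex (unsplitK (inl v)). Qed.

Lemma cone_map_cone a b (f : join_mor a b) i (v : 'I_(cone_nverts a i)) :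
  (b i <= cone_map f v)%N = (a i <= v)%N.
Proof.
rewrite /cone_map; case: splitP => u -> /=; last by rewrite !leq_addr.
by rewrite leqNgt ltn_ord leqNgt ltn_ord.
Qed.

Lemma has_cone_image a b (f : join_mor a b) (F : cell a) i :
  has_cone (cell_image f F) i = has_cone F i.
Proof.
rewrite /has_cone ffunE /=; apply/existsP/existsP => -[v].
  by move=> /andP[/imsetP[u uF ->]]; rewrite cone_map_cone => h; exists u; rewrite uF.
by move=> /andP[vF h]; exists (cone_map f v); rewrite imset_f // cone_map_cone.
Qed.

Lemma dim_image a b (f : join_mor a b) (F : cell a) i :
  sface_dim (cell_image f F i) = sface_dim (F i).
Proof. by rewrite ffunE sface_dim_image //; exact: cone_map_inj. Qed.

Lemma bad_cell_image a b (f : join_mor a b) (F : cell a) : bad_cell (cell_image f F) = bad_cell F.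
Proof. by do 2![apply: eq_existsb => ?]; rewrite has_cone_image dim_image. Qed.

Lemma base_image a b (f : join_mor a b) (F : cell a) :
  base (cell_image f F) = image_family f (base F).
Proof.
apply: vfamilyP => i; apply/setP => v; rewrite !inE.
have -> : live (cell_image f F) i = live F i.
  by apply: eq_forallb => j; rewrite has_cone_image.
rewrite ffunE /=; apply/andP/imsetP => [[lF /imsetP[u uF]]|[u]].
  rewrite /cone_map; case: splitP => w uw.
    move=> /lshift_inj->; exists w => //; rewrite inE lF /=.
    by rewrite (_ : base_vertex w = u) //; apply: val_inj.
  by move=> /(congr1 val) /= e; have := ltn_ord v; rewrite e ltnNge leq_addr.
rewrite inE => /andP[lF uF] ->; split=> //; rewrite -cone_map_base.
exact: imset_f.
Qed.

End Pull.

(** * Cochains of perversity zero and their differential on bad cells *)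

Section Differential.
Variables (R : idomainType) (n : nat).
Implicit Types (b : join_shape n).

Lemma tw_perverse0P b (w : tw_tensor R b) :
  tw_perverse zero_perversity w <-> forall F, bad_cell F -> w F = 0.
Proof.
split=> [h F /bad_cellP[i [j [ij Fi Fj]]]|h].
  apply/eqP; apply: contraTT Fj => nz; rewrite -eqn0Ngt.
  (* The perversity bound at level n - i tests factor i; this level is positive because i < j. *)
  have := forallP h (rev_ord i); rewrite /tw_norm rev_ordK.
  have -> /= : (0 < rev_ord i)%N by rewrite /= subn_gt0; have := ltn_ord j; lia.
  (* If factor i of the simplex is empty the norm is -oo, but then the only vertex of its cone is
     the cone point, contradicting [Fi]. *)
  case: eqP => [bi|_].
    move: Fi; have /set0Pn[v vF] := verts_neq0 (F i).
    by case/existsP; exists v; rewrite vF bi.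
  move=> /bigmax_leP[_ /(_ F)]; rewrite nz andbT.
  have -> : [forall v in verts (F i), (v < b i)%N].
    by apply: contraR Fi => /forall_inPn[v vF]; rewrite -leqNgt => vb; apply/existsP; exists v; rewrite vF.
  by move=> /(_ isT); rewrite lee_fin lez_nat leqn0 sum_nat_eq0 => /forall_inP/(_ j ij).
apply/forallP => l; apply/implyP => l0; rewrite /tw_norm; case: ifP => // _.
apply/bigmax_leP; split=> [|F /andP[Fb nz]]; first exact: leNye.
rewrite lee_fin lez_nat leqn0 sum_nat_eq0; apply/forall_inP => j ij.
rewrite eqn0Ngt; apply: contra nz => Fj; apply/eqP/h/(bad_cellI ij) => //.
apply/existsP => -[v /andP[vF]]; rewrite leqNgt.
by move/forall_inP: Fb => /(_ v vF) ->.
Qed.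

(** The value of w on the face of F that omits the vertex v of factor i; it is 0 when this would
    empty the factor. *)
Definition cell_face b (w : tw_tensor R b) (F : cell b) i (v : 'I_(cone_nverts b i)) : R :=
  face_ext (fun G : sface (cone_nverts b i) => w (cell_set F G)) (verts (F i) :\ v).

Lemma tw_diffE b (w : tw_tensor R b) F : tw_diff w F =
  \sum_(i < n.+1) (-1) ^+ (\sum_(j < n.+1 | (j < i)%N) sface_dim (F j)) *
  \sum_(v in verts (F i)) (-1) ^+ #|[set u in verts (F i) | (u < v)%N]| * cell_face w F v.
Proof. by rewrite ffunE. Qed.

Lemma cell_face0 b (w : tw_tensor R b) (F : cell b) i (v : 'I_(cone_nverts b i)) :
  v \in verts (F i) -> #|F i| = 1%N -> cell_face w F v = 0.
Proof.
move=> vF F1; rewrite /cell_face (_ : _ :\ v = set0) ?face_ext0 //.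
by apply/eqP; rewrite -cards_eq0; have := cardsD1 v (verts (F i)); rewrite vF F1 add1n => -[<-].
Qed.

Lemma cell_faceE b (w : tw_tensor R b) (F : cell b) i (v : 'I_(cone_nverts b i))
  (G : sface (cone_nverts b i)) : verts G = verts (F i) :\ v -> cell_face w F v = w (cell_set F G).
Proof. by move=> e; rewrite /cell_face -e face_extE. Qed.

Lemma cell_face_eq0 b (w : tw_tensor R b) (F : cell b) i (v : 'I_(cone_nverts b i)) :
  (forall G : sface (cone_nverts b i), verts G = verts (F i) :\ v -> w (cell_set F G) = 0) ->
  cell_face w F v = 0.
Proof.
move=> h; have [e|e] := eqVneq (verts (F i) :\ v) set0; first by rewrite /cell_face e face_ext0.
by rewrite (@cell_faceE _ _ _ _ _ (SFace e)) // h.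
Qed.

Lemma has_cone_set b (F : cell b) l (G : sface (cone_nverts b l)) i :
  verts G \subset verts (F l) -> ~~ has_cone F i -> ~~ has_cone (cell_set F G) i.
Proof.
move=> /subsetP GF; apply: contra => /existsP[v /andP[vG bv]]; apply/existsP; exists v.
rewrite bv andbT; move: vG; have [li|li] := eqVneq l i; last by rewrite cell_set_out.
by subst l; rewrite cell_set_in => /GF.
Qed.

Section VanishOnBad.
Variables (b : join_shape n) (w : tw_tensor R b).
Hypothesis w0 : forall F, bad_cell F -> w F = 0.
Variables (F : cell b) (i j : 'I_n.+1).
Hypotheses (ij : (i < j)%N) (Fi : ~~ has_cone F i).

(** Deleting a vertex of a factor other than j leaves factor i without cone point and [F j] of
    positive dimension: that face is still bad, and w vanishes on it. *)
Lemma tw_diff_bad : (0 < sface_dim (F j))%N -> tw_diff w F =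
  (-1) ^+ (\sum_(l < n.+1 | (l < j)%N) sface_dim (F l)) *
  \sum_(v in verts (F j)) (-1) ^+ #|[set u in verts (F j) | (u < v)%N]| * cell_face w F v.
Proof.
move=> Fj; rewrite tw_diffE (bigD1 j) //= [X in _ + X]big1 ?addr0 // => l lj.
rewrite [X in _ * X]big1 ?mulr0 // => v vF; rewrite cell_face_eq0 ?mulr0 // => G GF.
apply/w0/(bad_cellI ij); first by rewrite has_cone_set // GF subD1set.
by rewrite cell_set_out.
Qed.

Lemma tw_diff_bad3 : (1 < sface_dim (F j))%N -> tw_diff w F = 0.
Proof.
move=> Fj; rewrite tw_diff_bad ?(ltnW Fj) // [X in _ * X]big1 ?mulr0 // => v vF.
rewrite cell_face_eq0 ?mulr0 // => G GF.
apply/w0/(bad_cellI ij); first by rewrite has_cone_set // GF subD1set.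
rewrite cell_set_in /sface_dim /= GF.
by move: Fj; rewrite /sface_dim (cardsD1 v) vF add1n; case: #|_|.
Qed.

(** When [F j] is an edge, only its two endpoints contribute, with opposite signs. The common sign
    is left existential: only the vanishing of the difference matters later. *)
Lemma tw_diff_edge (u v : 'I_(cone_nverts b j)) (U V : sface (cone_nverts b j)) :
  (u < v)%N -> verts (F j) = [set u; v] -> verts U = [set u] -> verts V = [set v] ->
  exists e : nat, tw_diff w F = (-1) ^+ e * (w (cell_set F V) - w (cell_set F U)).
Proof.
move=> uv Fj Uu Vv; have nuv : u != v by apply: contraTneq uv => ->; rewrite ltnn.
rewrite tw_diff_bad; last by rewrite /sface_dim Fj cards2 nuv.
eexists; congr (_ * _); rewrite Fj big_setU1 ?inE //= big_set1; congr (_ + _).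
  rewrite (_ : [set _ in _ | _] = set0) ?cards0 ?mul1r.
    by apply: cell_faceE; rewrite Fj Vv setU1K // inE.
  by apply/setP => x; rewrite !inE; apply/negP => /andP[/orP[]/eqP-> //]; rewrite ?ltnn //; lia.
rewrite (_ : [set _ in _ | _] = [set u]) ?cards1 ?mulN1r.
  congr (- _); apply: cell_faceE; rewrite Fj Uu setUC setU1K // inE eq_sym //.
apply/setP => x; rewrite !inE; have [->|xu] /= := eqVneq x u; first by rewrite uv.
by apply/negP => /andP[/eqP->]; rewrite ltnn.
Qed.

End VanishOnBad.

Section Constancy.
Variables (b : join_shape n) (w : tw_tensor R b).
Hypothesis w0 : forall F, bad_cell F -> w F = 0.
Hypothesis dw0 : forall F, bad_cell F -> tw_diff w F = 0.

(* Evaluate the differential on the bad cell whose factor j is the edge joining G and H. *)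
Lemma const_vertex (F : cell b) (i j : 'I_n.+1) (G H : sface (cone_nverts b j)) :
  (i < j)%N -> ~~ has_cone F i -> sface_dim G = 0%N -> sface_dim H = 0%N ->
  w (cell_set F G) = w (cell_set F H).
Proof.
move=> ij Fi /eqP; rewrite sface_dim0 => /cards1P[u Gu] /eqP; rewrite sface_dim0 => /cards1P[v Hv].
wlog uv : u v G H Gu Hv / (u < v)%N => [hw|].
  have [uv|uv|/val_inj uv] := ltngtP u v; first exact: hw Gu Hv uv.
    by rewrite (hw v u H G).
  by congr (w (cell_set _ _)); apply: val_inj; rewrite /= Gu uv.
have E0 : [set u; v] != set0 by apply/set0Pn; exists u; rewrite !inE eqxx.
have nij : j != i by apply: contraTneq ij => ->; rewrite ltnn.
pose E := cell_set F (SFace E0).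
have Ei : ~~ has_cone E i by rewrite /has_cone cell_set_out.
have [|e] := @tw_diff_edge _ _ w0 E i j ij Ei u v G H uv _ Gu Hv; first by rewrite cell_set_in.
rewrite dw0; last first.
  apply: (bad_cellI ij Ei); rewrite cell_set_in /sface_dim /= cards2.
  by rewrite (_ : u != v) //; apply: contraTneq uv => ->; rewrite ltnn.
rewrite !cell_set_set => /esym/eqP; rewrite mulf_eq0 signr_eq0 /= subr_eq0 => /eqP.
by [].
Qed.

(** The base determines the factors up to the first coneless index t. After t the factors of a good
    cell are single vertices, and [const_vertex] exchanges them one at a time along the cells
    [H m]. *)
Lemma const_good (F F' : cell b) : ~~ bad_cell F -> ~~ bad_cell F' -> base F = base F' -> w F = w F'.
Proof.
move=> Fg Fg' e; have [t [Ft Fl]] := first_coneless F; have [t' [Ft' Fl']] := first_coneless F'.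
have mem (H : cell b) (s i : 'I_n.+1) : ~~ has_cone H s -> (forall i, live H i = (i <= s)%N) ->
    base H i != set0 -> (i <= s)%N.
  by move=> Hs Hl /set0Pn[v]; rewrite inE Hl => /andP[].
have top (H : cell b) (s : 'I_n.+1) : ~~ has_cone H s -> (forall i, live H i = (i <= s)%N) ->
    base H s != set0.
  move=> Hs Hl; have /set0Pn[v vH] := verts_neq0 (H s); apply/set0Pn.
  have vb : (v < b s)%N by rewrite ltnNge; apply: contra Hs => bv; apply/existsP; exists v; rewrite vH.
  exists (Ordinal vb); rewrite inE Hl leqnn /=.
  by rewrite (_ : base_vertex _ = v) //; apply: val_inj.
(* The first coneless index is the last one at which the base is non-empty, so it can be read off
   the base. *)
have tt : t = t'.
  apply/val_inj/anti_leq; rewrite (mem F' t' t) ?(mem F t t') //.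
    by rewrite e top.
  by rewrite -e top.
subst t'; have FE (i : 'I_n.+1) : (i <= t)%N -> F i = F' i.
  move=> it; apply: val_inj; apply/setP => v /=.
  have [bv|bv] := leqP (b i) v; last first.
    have := congr1 (fun A : vfamily b => Ordinal bv \in A i) e; rewrite !inE Fl Fl' it /=.
    by rewrite (_ : base_vertex _ = v) //; apply: val_inj.
  have uniqv (u : 'I_(cone_nverts b i)) : (b i <= u)%N -> u = v.
    move=> bu; apply: val_inj; have := ltn_ord u; have := ltn_ord v.
    have : (cone_nverts b i <= b i + 1)%N by rewrite leq_add2l leq_b1.
    by rewrite /=; lia.
  have coneE (H : cell b) : (v \in verts (H i)) = has_cone H i.
    apply/idP/existsP => [vH|[u /andP[uH /uniqv <-//]]].
    by exists v; rewrite vH.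
  rewrite !coneE; move: it; rewrite leq_eqVlt => /orP[/eqP/val_inj->|it].
    by rewrite (negPf Ft) (negPf Ft').
  have /liveP/(_ i it) -> : live F t by rewrite Fl.
  by have /liveP/(_ i it) -> : live F' t by rewrite Fl'.
pose H m : cell b := finfun (fun i : 'I_n.+1 => if (i < m)%N then F' i else F i).
suff h m : (m <= n.+1)%N -> w F = w (H m).
  rewrite (h n.+1) //; congr (w _); apply/ffunP => i.
  by rewrite ffunE ltn_ord.
elim: m => [_|m IH mn]; first by congr (w _); apply/ffunP => i; rewrite ffunE.
rewrite IH 1?ltnW //; pose j := Ordinal mn.
have HS : H m.+1 = cell_set (H m) (F' j).
  apply/ffunP => i; have [<-|ji] := eqVneq j i; first by rewrite cell_set_in ffunE /= leqnn.
  by rewrite cell_set_out // !ffunE ltnS leq_eqVlt [_ == m](_ : _ = false) //; apply/negbTE;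
   rewrite eq_sym.
have H0 : H m = cell_set (H m) (F j).
  apply/ffunP => i; have [<-|ji] := eqVneq j i; first by rewrite cell_set_in ffunE /= ltnn.
  by rewrite cell_set_out.
rewrite HS [in LHS]H0; case: (leqP j t) => jt; first by rewrite FE.
apply: (const_vertex (i := t)) => //.
- by rewrite /has_cone ffunE; case: ifP => _; [exact: Ft' | exact: Ft].
- exact: (good_cellP Fg jt Ft).
- exact: (good_cellP Fg' jt Ft').
Qed.

End Constancy.

End Differential.

(** * Base vertices and cone points of a cell *)

Section ConeVertices.
Variables (n : nat) (b : join_shape n).
Implicit Types (F : cell b) (i l t : 'I_n.+1).

Lemma cone_unique i (u v : 'I_(cone_nverts b i)) : (b i <= u)%N -> (b i <= v)%N -> u = v.
Proof.
move=> bu bv; apply: val_inj; have := ltn_ord u; have := ltn_ord v.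
have : (cone_nverts b i <= b i + 1)%N by rewrite leq_add2l leq_b1.
by rewrite /=; lia.
Qed.

Lemma base_vertexP i (v : 'I_(cone_nverts b i)) : (v < b i)%N -> exists u, v = base_vertex u.
Proof. by move=> vb; exists (Ordinal vb); apply: val_inj. Qed.

Lemma base_vertex_lt i (u : 'I_(b i)) : (base_vertex u < b i)%N.
Proof. by rewrite /= ltn_ord. Qed.

Lemma sum_cone_vertices (V : nmodType) i (S : {set 'I_(cone_nverts b i)})
    (f : 'I_(cone_nverts b i) -> V) :
  \sum_(v in S) f v =
  \sum_(u | base_vertex u \in S) f (base_vertex u) + \sum_(v in S | (b i <= v)%N) f v.
Proof.
rewrite (bigID (fun v : 'I_(cone_nverts b i) => (b i <= v)%N)) /= addrC; congr (_ + _).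
rewrite [LHS](eq_bigl (fun v => v \in @base_vertex n b i @: [set u | base_vertex u \in S])).
  rewrite big_imset /=; last by move=> x y _ _; exact: base_vertex_inj.
  by apply: eq_bigl => u; rewrite inE.
move=> v; rewrite -ltnNge; apply/andP/imsetP => [[vS /base_vertexP[u uv]]|[u]].
  by exists u; rewrite // inE -uv.
by rewrite inE => uS ->; rewrite base_vertex_lt.
Qed.

Lemma remove_cone F i v : v \in verts (F i) -> (b i <= v)%N ->
  verts (F i) :\ v = @base_vertex n b i @: [set u | base_vertex u \in verts (F i)].
Proof.
move=> vF bv; apply/setP => x; rewrite !inE; apply/andP/imsetP => [[xv xF]|[u]].
  have [bx|/base_vertexP[u xu]] := leqP (b i) x; last by exists u; rewrite // inE -xu.
  by rewrite (cone_unique bx bv) eqxx in xv.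
rewrite inE => uF ->; rewrite uF; split=> //.
by apply: contraTneq bv => <-; rewrite -ltnNge base_vertex_lt.
Qed.

Lemma below_cone F i v : v \in verts (F i) -> (b i <= v)%N ->
  [set u in verts (F i) | (u < v)%N] = verts (F i) :\ v.
Proof.
move=> vF bv; apply/setP => x; rewrite !inE andbC; apply: andb_id2r => xF.
have [bx|xb] := leqP (b i) x; first by rewrite (cone_unique bx bv) eqxx ltnn.
by rewrite (leq_trans xb bv); apply/esym; apply: contraTneq bv => <-; rewrite -ltnNge.
Qed.

Lemma card_base_live F i : live F i -> has_cone F i -> #|base F i| = sface_dim (F i).
Proof.
move=> Fl /existsP[v /andP[vF bv]]; rewrite /sface_dim (cardsD1 v) vF add1n /= remove_cone //.
rewrite card_imset; last exact: base_vertex_inj.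
by apply: eq_card => u; rewrite !inE Fl.
Qed.

Lemma verts_coneless F i : ~~ has_cone F i ->
  verts (F i) = @base_vertex n b i @: [set u | base_vertex u \in verts (F i)].
Proof.
move=> Fi; apply/setP => x; apply/idP/imsetP => [xF|[u]]; last by rewrite inE => uF ->.
have [bx|/base_vertexP[u xu]] := leqP (b i) x; last by exists u; rewrite // inE -xu.
by case/existsP: Fi; exists x; rewrite xF.
Qed.

Lemma below_base_vertex F i u : live F i ->
  #|[set v in verts (F i) | (v < @base_vertex n b i u)%N]| = #|[set v in base F i | (v < u)%N]|.
Proof.
move=> Fl; rewrite -[RHS](card_imset _ (@base_vertex_inj n b i)); apply: eq_card => x.
rewrite inE; apply/andP/imsetP => [[xF xu]|[y]].
  have [y xy] := base_vertexP (ltn_trans xu (base_vertex_lt u)); subst x.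
  by exists y; rewrite // !inE Fl xF.
by rewrite !inE Fl /= => /andP[yF yu] ->.
Qed.

(** Deleting a base vertex does not change which factors contain their cone point, and dimensions
    can only drop, so that a good cell stays good. *)
Lemma remove_base F l (u : 'I_(b l)) (G : sface (cone_nverts b l)) :
  ~~ bad_cell F -> verts G = verts (F l) :\ base_vertex u ->
  ~~ bad_cell (cell_set F G) /\ base (cell_set F G) = remove (base F) u.
Proof.
move=> Fg GF; have cE i : has_cone (cell_set F G) i = has_cone F i.
  have [li|li] := eqVneq l i; last by rewrite /has_cone cell_set_out.
  subst i; rewrite /has_cone cell_set_in; apply/existsP/existsP => -[v /andP[vF bv]]; exists v;
    move: vF; rewrite GF !inE bv andbT; first by case/andP.
  by move=> ->; rewrite andbT; apply: contraTneq bv => ->; rewrite -ltnNge base_vertex_lt.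
have lE i : live (cell_set F G) i = live F i by apply: eq_forallb => j; rewrite cE.
split.
  apply/negP => /bad_cellP[p [q [pq Fp]]]; rewrite cE in Fp; apply/negP; rewrite -eqn0Ngt -leqn0.
  rewrite -[X in (_ <= X)%N](good_cellP Fg pq Fp); have [lq|lq] := eqVneq l q; last by rewrite cell_set_out.
  by subst q; rewrite cell_set_in /sface_dim -!subn1 leq_sub2r // subset_leq_card // GF subD1set.
apply: vfamilyP => i; apply/setP => v; rewrite inE lE; have [li|li] := eqVneq l i.
  subst i; rewrite cell_set_in remove_in GF !inE (inj_eq (@base_vertex_inj n b l)).
  by rewrite andbCA.
by rewrite cell_set_out // remove_out // inE.
Qed.

Lemma coneless_removed F l v (G : sface (cone_nverts b l)) :
  v \in verts (F l) -> (b l <= v)%N -> verts G = verts (F l) :\ v -> ~~ has_cone (cell_set F G) l.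
Proof.
move=> vF bv GF; apply/existsP => -[u]; rewrite cell_set_in GF !inE => /andP[/andP[uv _] bu].
by rewrite (cone_unique bu bv) eqxx in uv.
Qed.

End ConeVertices.

(** * The transposed collapse commutes with the differentials *)

Section Collapse.
Variables (R : idomainType) (n : nat) (K : filtered_face_set n).
Local Notation simplex := (simplex K).
Local Notation chains := {freeg simplex / R}.
Variable (s : simplex).

(* Transpose of the collapse of the blow-up of a simplex onto the simplex. *)
Definition collapse (L : {linear chains -> R^o}) : tw_tensor R (sshape s) :=
  [ffun F => if bad_cell F then 0 else L (sub_chain R (base F))].

Lemma collapse_good L F : ~~ bad_cell F -> collapse L F = L (sub_chain R (base F)).
Proof. by move=> Fg; rewrite ffunE (negPf Fg). Qed.

Lemma collapse_bad L F : bad_cell F -> collapse L F = 0.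
Proof. by move=> Fb; rewrite ffunE Fb. Qed.

(** If [F j] has dimension at least 2, all faces involved are bad. If it is an edge, the two
    endpoints give cells with the same badness and the same base, and their contributions cancel. *)
Lemma collapse_diff_bad L F : bad_cell F -> tw_diff (collapse L) F = 0.
Proof.
move=> Fb; have [i [j [ij Fi Fj]]] := bad_cellP Fb.
have [Fj2|Fj1] := ltnP 1 (sface_dim (F j)); first exact: (tw_diff_bad3 (@collapse_bad L) ij Fi).
have c2 : #|F j| = 2 by rewrite sface_card; lia.
have /cards2P[u [v [uv Fuv]]] : #|verts (F j)| == 2 by rewrite c2.
wlog ltuv : u v uv Fuv / (u < v)%N => [hw|].
  have [h|h|/val_inj h] := ltngtP u v; first exact: hw uv Fuv h.
    by apply: (hw v u) h; rewrite 1?eq_sym // setUC.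
  by rewrite h eqxx in uv.
have u0 : [set u] != set0 by apply/set0Pn; exists u; rewrite inE.
have v0 : [set v] != set0 by apply/set0Pn; exists v; rewrite inE.
have [e ->] := @tw_diff_edge _ _ _ _ (@collapse_bad L) F i j ij Fi u v (SFace u0) (SFace v0)
  ltuv Fuv erefl erefl.
have [|||bE baseE] := @eq_bad_base n (sshape s) (cell_set F (SFace v0)) (cell_set F (SFace u0)) i j ij.
- by rewrite /has_cone cell_set_out //; apply: contraTneq ij => ->; rewrite ltnn.
- by move=> l lj; rewrite !cell_set_out // eq_sym.
- by rewrite !cell_set_in /sface_dim !cards1.
by rewrite !ffunE bE baseE subrr mulr0.
Qed.

Section Good.
Variables (L : {linear chains -> R^o}) (F : cell (sshape s)).
Hypothesis Fg : ~~ bad_cell F.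
Variable t : 'I_n.+1.
Hypothesis Ft : ~~ has_cone F t.
Hypothesis Fl : forall i, live F i = (i <= t)%N.
Local Notation b := (sshape s).
Local Notation A := (base F).
Local Notation w := (collapse L).
Local Notation deg l := (\sum_(j < n.+1 | (j < l)%N) sface_dim (F j))%N.

Lemma cone_lt (i : 'I_n.+1) : (i < t)%N -> has_cone F i.
Proof. by move=> it; have /liveP/(_ i it) : live F t by rewrite Fl. Qed.

Lemma card_gt (i : 'I_n.+1) : (t < i)%N -> #|F i| = 1%N.
Proof. by move=> ti; rewrite sface_card (good_cellP Fg ti Ft). Qed.

Lemma base_gt (i : 'I_n.+1) : (t < i)%N -> A i = set0.
Proof. by move=> ti; apply/setP => v; rewrite !inE Fl leqNgt ti. Qed.

Lemma card_base_lt (i : 'I_n.+1) : (i < t)%N -> #|A i| = sface_dim (F i).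
Proof. by move=> it; rewrite card_base_live ?cone_lt // Fl ltnW. Qed.

(** The sign of the tensor product agrees with that of the join: before t each factor contains its
    cone point, so its dimension is its number of base vertices. *)
Lemma deg_base (l : 'I_n.+1) : (l <= t)%N -> (\sum_(j < n.+1 | (j < l)%N) #|A j|)%N = deg l.
Proof. by move=> lt; apply: eq_bigr => i il; rewrite card_base_lt // (leq_trans il). Qed.

(** The differential at F is split, factor by factor, into the removal of base vertices and the
    removal of the cone point ([cone_part]). Both are compared with [face_part], the share of factor
    l in the boundary of the base. *)
Definition base_part (l : 'I_n.+1) : R := (-1) ^+ deg l *
  \sum_(u | base_vertex u \in verts (F l))
    (-1) ^+ #|[set v in verts (F l) | (v < base_vertex u)%N]| * cell_face w F (base_vertex u).

Definition cone_part (l : 'I_n.+1) : R := (-1) ^+ deg l *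
  \sum_(v in verts (F l) | (b l <= v)%N)
    (-1) ^+ #|[set u in verts (F l) | (u < v)%N]| * cell_face w F v.

Definition face_part (l : 'I_n.+1) : R := \sum_(u in A l)
  (-1) ^+ (\sum_(j < n.+1 | (j < l)%N) #|A j| + #|[set v in A l | (v < u)%N]|)
  * L (sub_chain R (remove A u)).

Lemma tw_diff_parts : tw_diff w F = \sum_l base_part l + \sum_l cone_part l.
Proof.
rewrite tw_diffE -big_split; apply: eq_bigr => l _.
by rewrite sum_cone_vertices mulrDr.
Qed.

Lemma boundary_parts : L (chain_boundary (sub_chain R A)) = \sum_l face_part l.
Proof.
rewrite boundary_sub_chain linear_sum; apply: eq_bigr => l _.
by rewrite linear_sum; apply: eq_bigr => u _; rewrite linearZ.
Qed.

Lemma base_part_eq (l : 'I_n.+1) : (l <= t)%N -> (1 < #|F l|)%N -> base_part l = face_part l.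
Proof.
move=> lt F2; rewrite /base_part mulr_sumr; apply: eq_big => u; first by rewrite inE Fl lt.
move=> uF; rewrite below_base_vertex ?Fl // mulrA -exprD deg_base //; congr (_ * _).
have G0 : verts (F l) :\ base_vertex u != set0.
  by rewrite -card_gt0; move: F2; rewrite (cardsD1 (base_vertex u)) uF.
have [//|bg be] := @remove_base _ _ F l u (SFace G0) Fg.
by rewrite (@cell_faceE _ _ _ _ _ _ _ (SFace G0)) // collapse_good // be.
Qed.

Lemma base_part0 (l : 'I_n.+1) : #|F l| = 1%N -> base_part l = 0.
Proof. by move=> F1; rewrite /base_part [X in _ * X]big1 ?mulr0 // => u uF; rewrite cell_face0 ?mulr0. Qed.

Lemma cone_part_ge0 (l : 'I_n.+1) : (t <= l)%N -> cone_part l = 0.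
Proof.
move=> tl; rewrite /cone_part [X in _ * X]big1 ?mulr0 // => v /andP[vF bv]; move: tl.
rewrite leq_eqVlt => /orP[/eqP/val_inj tl|tl]; last by rewrite cell_face0 ?mulr0 ?card_gt.
by subst l; case/existsP: Ft; exists v; rewrite vF.
Qed.

Lemma cone_part0 (l : 'I_n.+1) : (forall v (G : sface (cone_nverts b l)), v \in verts (F l) ->
    (b l <= v)%N -> verts G = verts (F l) :\ v -> ~~ has_cone (cell_set F G) l ->
    bad_cell (cell_set F G)) ->
  cone_part l = 0.
Proof.
move=> h; rewrite /cone_part [X in _ * X]big1 ?mulr0 // => v /andP[vF bv].
rewrite cell_face_eq0 ?mulr0 // => G GF; apply/collapse_bad/(h v) => //.
exact: coneless_removed GF.
Qed.

Lemma base_face_part (l : 'I_n.+1) : l != t -> base_part l = face_part l.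
Proof.
rewrite neq_ltn => /orP[lt|tl]; last first.
  by rewrite base_part0 ?card_gt // /face_part base_gt // big_set0.
have [F2|F2] := ltnP 1 #|F l|; first by rewrite base_part_eq // ltnW.
(* Here [F l] is the cone point alone, so the base is empty at l. *)
have F1 : #|F l| = 1%N by rewrite sface_card in F2 *; lia.
rewrite base_part0 // /face_part (_ : A l = set0) ?big_set0 //; apply/eqP.
by rewrite -cards_eq0 card_base_lt // /sface_dim F1.
Qed.

(* The face of the simplex obtained by removing the only vertex of G_t corresponds, when
   G_l is the last non-empty factor before t, to the face of F in which the cone point of
   the factor l is removed; all other cone-point faces are bad. *)
Lemma collapse_diff_good : tw_diff w F = L (chain_boundary (sub_chain R A)).
Proof.
rewrite tw_diff_parts boundary_parts (bigD1 t) //= [in RHS](bigD1 t) //=.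
rewrite (eq_bigr _ base_face_part) addrAC [in RHS]addrC [LHS]addrC; congr (_ + _).
(* If [F t] has positive dimension, removing a cone point before t produces a bad cell, so that only
   base vertices contribute. *)
have [F2|F1] := ltnP 1 #|F t|.
  rewrite base_part_eq // big1 ?addr0 // => l _; have [lt|] := ltnP l t; last exact: cone_part_ge0.
  apply: cone_part0 => v G vF bv GF Gl; apply: (bad_cellI lt) => //.
  by rewrite cell_set_out; [move: F2; rewrite sface_card | apply: contraTneq lt => ->; rewrite ltnn].
have {}F1 : #|F t| = 1%N by rewrite sface_card in F1 *; lia.
rewrite base_part0 // add0r.
have [u Au] : exists u, A t = [set u].
  apply/cards1P; rewrite -(card_imset _ (@base_vertex_inj _ _ t)).
  rewrite (_ : A t = [set u | base_vertex u \in verts (F t)]) -?verts_coneless ?F1 //.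
  by apply/setP => u; rewrite !inE Fl leqnn.
have -> : face_part t = (-1) ^+ deg t * L (sub_chain R (remove A u)).
  rewrite /face_part Au big_set1 deg_base // (_ : [set v in [set u] | _] = set0) ?cards0 ?addn0 //.
  by apply/setP => v; rewrite !inE; apply/negP => /andP[/eqP->]; rewrite ltnn.
have rem0 (l : 'I_n.+1) : (t <= l)%N -> remove A u l = set0.
  rewrite leq_eqVlt => /orP[/eqP/val_inj tl|tl].
    by subst l; rewrite remove_in Au setDv.
  by rewrite remove_out ?base_gt //; apply: contraTneq tl => ->; rewrite ltnn.
have remE (l : 'I_n.+1) : (l < t)%N -> remove A u l = A l.
  by move=> lt; rewrite remove_out //; apply: contraTneq lt => ->; rewrite ltnn.
have coneE (l : 'I_n.+1) v (G : sface (cone_nverts b l)) : (l < t)%N -> v \in verts (F l) ->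
    (b l <= v)%N -> verts G = verts (F l) :\ v -> A l != set0.
  move=> lt vF bv GF; have /set0Pn[x] := verts_neq0 G.
  rewrite GF remove_cone // => /imsetP[y]; rewrite inE => yF _.
  by apply/set0Pn; exists y; rewrite inE Fl ltnW.
(* If no factor before t carries a base vertex, the base is the single vertex u with zero boundary,
   and removing a cone point would empty its factor. Otherwise the last such factor supplies the
   missing face. *)
have [/existsP[l0]|none] := boolP [exists l : 'I_n.+1, (l < t)%N && (A l != set0)]; last first.
  have A0 (l : 'I_n.+1) : (l < t)%N -> A l = set0.
    move=> lt; apply/eqP; move/existsPn: none => /(_ l).
    by rewrite lt negbK.
  rewrite big1 => [|l _].
    rewrite sub_chain0 ?linear0 ?mulr0 // => l; have [lt|/rem0//] := ltnP l t.
    by rewrite remE ?A0.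
  have [lt|] := ltnP l t; last exact: cone_part_ge0.
  apply: cone_part0 => v G vF bv GF.
  by have := coneE _ _ _ lt vF bv GF; rewrite A0 ?eqxx.
case/(@arg_maxnP _ l0 (fun l : 'I_n.+1 => (l < t)%N && (A l != set0)) val).
move=> l /andP[lt Al] lmax; have {}lmax (i : 'I_n.+1) : (l < i)%N -> (i < t)%N -> A i = set0.
  move=> li it; apply/eqP; apply: contraTT li => Ai; rewrite -leqNgt.
  by apply: lmax; rewrite it.
have /existsP[v /andP[vF bv]] := cone_lt lt.
rewrite (bigD1 l) //= [X in _ + X]big1 ?addr0; last first.
  move=> i il; have [it|] := ltnP i t; last exact: cone_part_ge0.
  apply: cone_part0 => x G xF bx GF Gi; have := coneE _ _ _ it xF bx GF.
  have [li|li|/val_inj li] := ltngtP i l; last by rewrite li eqxx in il.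
    move=> _; apply: (bad_cellI li Gi); rewrite cell_set_out // -card_base_lt //.
    by rewrite card_gt0.
  by rewrite lmax ?eqxx.
rewrite /cone_part (big_pred1 v); last first.
  move=> x; apply/andP/eqP => [[_ bx]|->//]; exact: cone_unique bx bv.
have G0 : verts (F l) :\ v != set0.
  rewrite remove_cone //; have /set0Pn[x] := Al; rewrite inE => /andP[_ xF].
  by apply/set0Pn; exists (base_vertex x); rewrite imset_f ?inE.
rewrite (@cell_faceE _ _ _ _ _ _ _ (SFace G0)) // mulrA -exprD below_cone //.
have Gl := @coneless_removed _ _ F l v (SFace G0) vF bv erefl.
have dimG (i : 'I_n.+1) : (l < i)%N -> sface_dim (F i) = 0%N.
  move=> li; have [it|ti|/val_inj ti] := ltngtP i t.
  - by rewrite -card_base_lt // lmax ?cards0.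
  - exact: (good_cellP Fg ti Ft).
  - by apply/eqP; rewrite sface_dim0 ti F1.
rewrite collapse_good; last first.
  apply/negP => /bad_cellP[p [q [pq Fp]]].
  have lp : (l <= p)%N.
    rewrite leqNgt; apply: contra Fp => pl; rewrite (eq_has_cone (F' := F)).
      exact/cone_lt/(ltn_trans pl).
    by rewrite cell_set_out //; apply: contraTneq pl => ->; rewrite ltnn.
  have lq := leq_ltn_trans lp pq.
  by rewrite cell_set_out ?dimG //; apply: contraTneq lq => ->; rewrite ltnn.
congr (_ * _); last congr (L (sub_chain R _)).
  (* The cone point of factor l is preceded there by [sface_dim (F l)] vertices, and the factors
     strictly between l and t have dimension 0; the two exponents are therefore equal. *)
  congr (_ ^+ _).
  rewrite (_ : #|verts (F l) :\ v| = sface_dim (F l)); last first.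
    by rewrite /sface_dim [in RHS](cardsD1 v) vF.
  rewrite [in RHS](bigD1 l) //= [RHS]addnC; congr (_ + _)%N.
  rewrite big_mkcond [RHS]big_mkcond; apply: eq_bigr => i _ /=.
  have [il|il|/val_inj ->] := ltngtP i l; last by rewrite eqxx andbF.
    rewrite (ltn_trans il lt) /= ifT //.
    by apply: contraTneq il => ->; rewrite ltnn.
  by case: ifP => //; rewrite dimG.
have livel i : live (cell_set F (SFace G0)) i = (i <= l)%N.
  apply/liveP/idP => [h|il j ji].
    by rewrite leqNgt; apply: contra Gl => /h.
  rewrite (eq_has_cone (F' := F)); first exact/cone_lt/(leq_ltn_trans _ lt)/ltnW/(leq_trans ji).
  by rewrite cell_set_out //; apply: contraTneq (leq_trans ji il) => ->; rewrite ltnn.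
apply: vfamilyP => i; apply/setP => x; rewrite inE livel.
have [il|li|/val_inj il] := ltngtP i l.
- rewrite remE ?(ltn_trans il) // inE Fl (ltnW (ltn_trans il lt)) cell_set_out //.
  by apply: contraTneq il => ->; rewrite ltnn.
- have [it|ti] := ltnP i t; last by rewrite rem0 // inE.
  by rewrite remE // lmax // inE.
subst i; rewrite remE // !inE Fl (ltnW lt) cell_set_in !inE /=.
by rewrite (_ : base_vertex x != v) //; apply: contraTneq bv => <-; rewrite -ltnNge base_vertex_lt.
Qed.

End Good.

End Collapse.

(** * The TW complex of a normal face set *)

Section Prisms.
Variables (n : nat) (b : join_shape n).

(** Factors before t lose their cone point, factors after t have dimension 0 and disappear, and only
    factor t contributes its dimension plus one. *)
Lemma card_base_good (F : cell b) : ~~ bad_cell F -> (\sum_i #|base F i| = (cell_dim F).+1)%N.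
Proof.
move=> Fg; have [t [Ft Fl]] := first_coneless F.
rewrite /cell_dim (bigD1 t) //= [in RHS](bigD1 t) //= -addSn; congr (_ + _)%N.
  rewrite -sface_card -(card_imset _ (@base_vertex_inj _ b t)).
  rewrite (_ : base F t = [set u | base_vertex u \in verts (F t)]) -?verts_coneless //.
  by apply/setP => u; rewrite !inE Fl leqnn.
apply: eq_bigr => i; rewrite neq_ltn => /orP[it|ti].
  by rewrite card_base_live ?Fl 1?ltnW //; have /liveP/(_ i it) : live F t by rewrite Fl.
rewrite (good_cellP Fg ti Ft); apply/eqP; rewrite cards_eq0; apply/eqP/setP => v.
by rewrite !inE Fl leqNgt ti.
Qed.

Hypothesis rb : regular b.

Lemma cone_nverts_gt0 i : (0 < cone_nverts b i)%N.
Proof.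
rewrite /cone_nverts; have [->|//] := eqVneq i ord_max; last by rewrite addn1.
by rewrite addn0.
Qed.

(** The cone point of factor i for i < n, and an actual vertex for i = n, where the last factor is
    non-empty by regularity. *)
Definition last_vertex i : 'I_(cone_nverts b i) :=
  Ordinal (etrans (ltn_predL _) (cone_nverts_gt0 i)).

Lemma good_cell_exists (A : vfamily b) : (0 < \sum_i #|A i|)%N ->
  exists F : cell b, ~~ bad_cell F /\ base F = A.
Proof.
rewrite lt0n sum_nat_eq0 negb_forall => /existsP[i0]; rewrite /= cards_eq0 => Ai0.
case/(@arg_maxnP _ i0 (fun i => A i != set0) val): Ai0 => t At tmax.
have Agt (i : 'I_n.+1) : (t < i)%N -> A i = set0.
  by move=> ti; apply/eqP; apply: contraTT ti => /tmax; rewrite -leqNgt.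
(* Before t this is the cone on [A i], at t it is [A t], and after t it is a single vertex. *)
pose S i := [set v : 'I_(cone_nverts b i) |
  (v \in @base_vertex _ b i @: A i) || ((i != t) && (v == last_vertex i))].
have S0 i : S i != set0.
  have [->|it] := eqVneq i t.
    by have /set0Pn[v vA] := At; apply/set0Pn; exists (base_vertex v); rewrite inE imset_f.
  by apply/set0Pn; exists (last_vertex i); rewrite inE it eqxx orbT.
pose F : cell b := finfun (fun i => SFace (S0 i)).
have FE i : verts (F i) = S i by rewrite ffunE.
have coneF (i : 'I_n.+1) : (i < t)%N -> has_cone F i.
  move=> it; have imax : i != ord_max by rewrite neq_ltn (leq_trans it) // -ltnS.
  apply/existsP; exists (last_vertex i); rewrite FE inE eqxx andbT neq_ltn it orbT /=.
  by rewrite /cone_nverts imax addn1.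
have coneFt : ~~ has_cone F t.
  apply/existsP => -[v]; rewrite FE inE eqxx orbF => /andP[/imsetP[u _ ->]].
  by rewrite leqNgt base_vertex_lt.
have Fl i : live F i = (i <= t)%N.
  apply/liveP/idP => [h|it j ji]; last exact/coneF/(leq_trans ji).
  by rewrite leqNgt; apply: contra coneFt => /h.
exists F; split.
  apply/negP => /bad_cellP[p [q [pq Fp]]]; apply/negP; rewrite -eqn0Ngt sface_dim0.
  have tp : (t <= p)%N by rewrite leqNgt; apply: contra Fp => /coneF.
  have tq := leq_ltn_trans tp pq.
  apply/cards1P; exists (last_vertex q); apply/setP => v.
  by rewrite FE !inE Agt // imset0 inE neq_ltn tq orbT.
apply: vfamilyP => i; apply/setP => v; rewrite inE Fl FE inE (mem_imset _ _ (@base_vertex_inj _ b i)).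
have [it|ti|it] := ltngtP i t; last first.
- by rewrite [i == t](introT eqP (val_inj it)) orbF.
- by rewrite Agt // inE.
rewrite /= [X in _ || X](_ : _ = false) ?orbF //; apply/negP => /andP[_ /eqP/(congr1 val)] /=.
have imax : i != ord_max by rewrite neq_ltn (leq_trans it) // -ltnS.
by rewrite /cone_nverts imax addn1 /= => e; have := ltn_ord v; rewrite e ltnn.
Qed.

End Prisms.

(** * Simplicial cochains as the TW-cochains of perversity zero *)

Section TWIso.
Variables (R : idomainType) (n : nat) (K : filtered_face_set n).
Local Notation simplex := (simplex K).
Local Notation chains := {freeg simplex / R}.
Local Notation cochains := (dual_complex (simplicial_chain_complex R K)).
Local Notation tw := (tw_complex R K zero_perversity).

Lemma nvert_sub (s : simplex) (A : vfamily (sshape s)) (A0 : (0 < \sum_i #|A i|)%N) :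
  nvert (sub_shape A0) = (\sum_i #|A i|)%N.
Proof. by apply: eq_bigr => i _; rewrite sub_shapeE. Qed.

Lemma sdim_sub (s : simplex) (F : cell (sshape s)) (A0 : (0 < \sum_i #|base F i|)%N) :
  ~~ bad_cell F -> sdim (sub_simplex A0) = cell_dim F.
Proof. by move=> Fg; rewrite /sdim /join_dim nvert_sub card_base_good. Qed.

Definition collapse_family k (f : cochains k) : tw_family R K :=
  fun s => collapse (sval s) (free_lift (values f)).

Lemma collapse_family_spec k (f : cochains k) : tw_spec zero_perversity k (collapse_family f).
Proof.
split=> [a b g s ra rb|s F|s|s].
- apply/ffunP => F; rewrite !ffunE bad_cell_image; case: ifP => // _.
  by rewrite base_image (@sub_chain_restr _ _ R a (mk_simplex s)).
- rewrite ffunE; case: ifP => [|/negbT Fg]; first by rewrite eqxx.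
  have A0 : (0 < \sum_i #|base F i|)%N by rewrite card_base_good.
  rewrite (sub_chainE _ A0) free_liftU; apply: contra_neq_eq => h.
  by apply: values0; rewrite sdim_sub.
- by apply/tw_perverse0P => F; exact: collapse_bad.
- by apply/tw_perverse0P => F; exact: collapse_diff_bad.
Qed.

Lemma collapse_map_subproof k (f : cochains k) :
  collapse_family f \in spred (Submodule (@tw_spec_closed R n K zero_perversity k)).
Proof. exact/asboolP/collapse_family_spec. Qed.

Definition collapse_map k (f : cochains k) : tw k := Submod (collapse_map_subproof f).

Lemma collapse_map_linear k : linear (@collapse_map k).
Proof.
move=> a f g; apply: val_inj; apply: functional_extensionality_dep => s.
apply/ffunP => F; rewrite !ffunE; case: ifP => _; first by rewrite scaler0 addr0.
exact: free_lift_lin.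
Qed.

Lemma collapse_map0 k : collapse_map (0 : cochains k) = 0.
Proof. exact: (linear0 (mk_linear (@collapse_map_linear k))). Qed.

Lemma collapse_mapd k (f : cochains k) :
  collapse_map (coboundary cochains k f) = coboundary tw k (collapse_map f).
Proof.
apply: val_inj; apply: functional_extensionality_dep => s; apply/ffunP => F.
have [Fb|Fg] := boolP (bad_cell F).
  by rewrite collapse_bad // [RHS]collapse_diff_bad.
have [t [Ft Fl]] := first_coneless F.
rewrite collapse_good // [RHS](collapse_diff_good _ Fg Ft Fl).
apply: (eq_free (g := free_lift (values f) \o
  mk_linear (fun a x y => linearP (@chain_boundary R n K) a x y))).
by move=> u _; rewrite free_liftU values_coboundary.
Qed.

Section Normal.
Hypothesis hK : normal_face_set K.

Lemma coface_exists (s : simplex) : exists x : coface s, True.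
Proof.
have [rs|rs] := boolP (regular (sshape s)).
  by exists (Coface rs (FaceIncl (restr_id (tagged s)))).
by have [t [rt [f]]] := proj1 hK s rs; exists (Coface rt f).
Qed.

Definition coface_reg (s : simplex) (x : coface s) : reg_simplex K :=
  exist (fun t : simplex => regular (sshape t)) x (coface_regular x).

Lemma compatible_incl (w : tw_family R K) (s t : reg_simplex K) (v : face_incl (sval s) (sval t)) :
  tw_compatible w -> w s = tw_pull v (w t).
Proof.
move=> h; have H a b (f : join_mor a b) (x : K b) (y : K a) (ra : regular a) (rb : regular b) :
  restr K f x = y -> w (mk_reg y ra) = tw_pull f (w (mk_reg x rb)) by move<-; exact: h.
by case: s t v => [[a s] ra] [[b t] rb] [f fP]; exact: H.
Qed.

Variables (k : nat) (w : tw k).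

Lemma tw_bad (s : reg_simplex K) F : bad_cell F -> val w s F = 0.
Proof. by have /asboolP[_ _ h _] := submodP w; exact: (proj1 (tw_perverse0P _) (h s)). Qed.

Lemma tw_diff_bad0 (s : reg_simplex K) F : bad_cell F -> tw_diff (val w s) F = 0.
Proof. by have /asboolP[_ _ _ h] := submodP w; exact: (proj1 (tw_perverse0P _) (h s)). Qed.

Lemma tw_const (s : reg_simplex K) (F F' : cell (sshape (sval s))) :
  ~~ bad_cell F -> ~~ bad_cell F' -> base F = base F' -> val w s F = val w s F'.
Proof. by apply: const_good => F0; [exact: tw_bad | exact: tw_diff_bad0]. Qed.

(** Such a cell collapses onto the face s of x, so the collapse of a cochain f takes on it the value
    of f at s. *)
Definition represents (s : simplex) (x : coface s) (F : cell (sshape x)) :=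
  ~~ bad_cell F /\ base F = image_family (coface_incl x) (@full_family _ _).

Arguments represents {s} x F.

Lemma represents_exists (s : simplex) (x : coface s) : exists F, represents x F.
Proof. exact/good_cell_exists/image_full_gt0/coface_regular. Qed.

(** By compatibility, F may be replaced by its image in y, whose base is the image of s under the
    composite inclusion. Since [coface_le] respects the inclusions of s, this is the base of F', and
    [tw_const] applies. *)
Lemma tw_coface_le (s : simplex) (x y : coface s) F F' : coface_le x y ->
  represents x F -> represents y F' -> val w (coface_reg x) F = val w (coface_reg y) F'.
Proof.
move=> [v vE] [Fg Fb] [Fg' Fb']; have /asboolP[h _ _ _] := submodP w.
have wE : val w (coface_reg x) = tw_pull v (val w (coface_reg y)) by exact: compatible_incl.
rewrite wE ffunE.
apply: tw_const => //; first by rewrite bad_cell_image.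
rewrite base_image Fb Fb' -vE; apply: vfamilyP => i.
by rewrite /image_family -imset_comp.
Qed.

(** A regular s is a coface of itself, below all the others; for a singular s the zigzag of
    normality is followed step by step. *)
Lemma tw_coface (s : simplex) (x y : coface s) F F' :
  represents x F -> represents y F' -> val w (coface_reg x) F = val w (coface_reg y) F'.
Proof.
move=> xF yF'; have [rs|rs] := boolP (regular (sshape s)).
  pose i0 : coface s := Coface rs (FaceIncl (restr_id (tagged s))).
  have [F0 iF0] := represents_exists i0.
  have le (z : coface s) : coface_le i0 z.
    by exists (coface_incl z); apply: join_mor_eqP.
  by rewrite -(tw_coface_le (le x) iF0 xF) (tw_coface_le (le y) iF0 yF').
have [m [z [z0 zm zle]]] := proj2 hK s rs x y.
have h i : (i <= m.+1)%N -> forall G, represents (z i.*2) G ->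
    val w (coface_reg x) F = val w (coface_reg (z i.*2)) G.
  elim: i => [_|i IH im G zG].
    by rewrite /= z0 => G [Gg Gb]; case: xF => Fg Fb; apply: tw_const; rewrite // Fb Gb.
  have [G1 zG1] := represents_exists (z i.*2); have [G2 zG2] := represents_exists (z i.*2.+1).
  have [le1 le2] := zle i im.
  by rewrite (IH (ltnW im) _ zG1) (tw_coface_le le1 zG1 zG2) (tw_coface_le le2 zG zG2).
by move: (h m.+1 (leqnn _)); rewrite doubleS zm; apply.
Qed.

Lemma collapse_map_surj : exists f, collapse_map f = w.
Proof.
pose x0 s := projT1 (cid (coface_exists s)).
(* The cochain is read off w on any cell representing s in any coface; [tw_coface] makes the choices
   irrelevant. *)
pose g s : R^o := val w (coface_reg (x0 s)) (projT1 (cid (represents_exists (x0 s)))).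
have gE s (y : coface s) F : represents y F -> g s = val w (coface_reg y) F.
  by rewrite /g; case: cid => F0 F0P; exact: tw_coface.
have g0 s : sdim s != k -> g s = 0.
  rewrite /g; case: cid => F0 [Fg F0b] /= sk; apply/eqP; apply: contraNT sk => nz.
  have /asboolP[_ h _ _] := submodP w; rewrite -(h _ _ nz).
  have sE : (sdim s).+1 = nvert (sshape s) by apply: prednK; exact: nverts_gt0.
  rewrite -eqSS sE -card_base_good // F0b.
  by apply/eqP/eq_bigr => i _; rewrite card_image_family card_full.
have [f fg] := cochain_of_values g0; exists f.
apply: val_inj; apply: functional_extensionality_dep => s; apply/ffunP => F.
have [Fb|Fg] := boolP (bad_cell F); first by rewrite collapse_bad // tw_bad.
rewrite collapse_good //.
have A0 : (0 < \sum_i #|base F i|)%N by rewrite card_base_good.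
rewrite (sub_chainE _ A0) free_liftU fg.
pose y : coface (sub_simplex A0) := @Coface _ _ (sub_simplex A0) (sval s) (svalP s)
  (@FaceIncl _ _ (sub_simplex A0) (sval s) (sub_mor A0) erefl).
rewrite (gE _ y F); last by split; rewrite //= image_sub_mor.
have eta (v : tw_family R K) (u : reg_simplex K) (ru : regular (sshape (sval u))) :
  v (exist _ (sval u) ru) = v u by case: u ru => u ru ru'; rewrite (bool_irrelevance ru' ru).
by rewrite /coface_reg /= eta.
Qed.

End Normal.

(** Every simplex has a coface in which some good cell represents it, so each value of f appears in
    its collapse. *)
Lemma collapse_map_inj (hK : normal_face_set K) k : injective (@collapse_map k).
Proof.
move=> f g e; apply: values_inj; apply/funext => s.
have [x _] := coface_exists hK s; have [F [Fg Fb]] := represents_exists x.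
have := congr1 (fun w : tw k => val w (coface_reg x) F) e.
rewrite /= !collapse_good // Fb (sub_chainE _ (image_full_gt0 _)) !free_liftU.
by rewrite -restr_incl.
Qed.

Lemma H_simp_TW (hK : normal_face_set K) k : lmod_iso (H_simp R K k) (H_TW R zero_perversity K k).
Proof.
apply: (@quasi_iso_lmod_iso _ _ _ (fun k => mk_linear (@collapse_map_linear k))).
- exact: collapse_mapd.
- case: k => [|k] f fd.
    by move=> e; apply: (collapse_map_inj hK); rewrite collapse_map0.
  move=> [w]; have [g <-] := collapse_map_surj hK w; rewrite -collapse_mapd.
  by move=> /(collapse_map_inj hK) e; exists g.
move=> w wd; have [f fw] := collapse_map_surj hK w; exists f.
  by apply: (collapse_map_inj hK); rewrite collapse_mapd fw collapse_map0.
by rewrite /= fw subrr; exact: is_coboundary0.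
Qed.

End TWIso.

(** * Connectedness of links *)

Section Links.
Variables (R : idomainType) (n : nat) (K : filtered_face_set n).
Local Notation simplex := (simplex K).
Local Notation chains := {freeg simplex / R}.
Implicit Types (s t u : simplex) (c : chains).

Definition sing (a : join_shape n) : nat := (\sum_(i < n.+1 | i != ord_max) a i)%N.

Definition admissible : pred simplex := fun s => (sing (sshape s) == 0%N) || (1 < sshape s ord_max)%N.

Lemma nvert_sing (a : join_shape n) : nvert a = (sing a + a ord_max)%N.
Proof. by rewrite /nvert (bigD1 ord_max) //= addnC. Qed.

Lemma sdim_sing s : (sdim s).+1 = (sing (sshape s) + sshape s ord_max)%N.
Proof. by rewrite -nvert_sing /sdim /join_dim prednK // nverts_gt0. Qed.

(** The condition at level l says that the number [v l] of vertices in the factors of index at most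
    n - l is 0 or less than the dimension. Level 1 is the strongest, with [v 1] the number of
    singular vertices; it then asks for two vertices in the last factor. *)
Lemma gm_admissibleE : gm_admissible tprime_perversity = admissible.
Proof.
apply/funext => s; rewrite /gm_admissible /admissible.
pose v (l : nat) := (\sum_(i < n.+1 | (i <= n - l)%N) sshape s i)%N.
have normE (l : nat) : (0 < l)%N ->
    (gm_norm l (sshape s) <= ((sdim s)%:Z - l%:Z + tprime_perversity l)%:E)%E =
    (v l == 0%N) || (v l + 1 <= sdim s)%N.
  move=> l0; rewrite /gm_norm /tprime_perversity -/(v l).
  have [->|v0] := eqVneq (v l) 0%N; first by rewrite leNye.
  rewrite lee_fin (_ : (l == 0)%N = false) /=; last by lia.
  by apply/idP/idP; lia.
have sE := sdim_sing s.
have v_sing (l : nat) : (0 < l <= n)%N -> (v l <= sing (sshape s))%N.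
  move=> ln; rewrite /v /sing big_mkcond [X in (_ <= X)%N]big_mkcond; apply: leq_sum => i _.
  by case: ifP => // il; case: eqP => // im; move: il; rewrite im /=; lia.
apply/forallP/orP => [h|h l]; last first.
  apply/implyP => l0; rewrite normE //.
  have := v_sing l; rewrite l0 -ltnS ltn_ord => /(_ isT) vl.
  by case: h => [/eqP h|h]; lia.
(* For n = 0 there is no level to test, but no singular vertex either. *)
case: (posnP n) => [n0|n0].
  left; rewrite /sing big1 // => i; rewrite -val_eqE /=; have := ltn_ord i; lia.
have l1 : (1 < n.+1)%N by [].
have := h (Ordinal l1); rewrite normE //= (_ : v 1%N = sing (sshape s)).
  by case/orP => [->|]; [left | right; lia].
by apply: eq_bigl => i; rewrite -val_eqE /=; have := ltn_ord i; lia.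
Qed.

Lemma sing_sub s (A : vfamily (sshape s)) (A0 : (0 < \sum_i #|A i|)%N) :
  sing (sub_shape A0) = (\sum_(i < n.+1 | i != ord_max) #|A i|)%N.
Proof. by apply: eq_bigr => i _; rewrite sub_shapeE. Qed.

Lemma supp_sub_chain (P : pred simplex) s (A : vfamily (sshape s)) :
  (forall A0, P (@sub_simplex _ _ s A A0)) -> all P (dom (sub_chain R A)).
Proof.
move=> h; rewrite /sub_chain; case: eqP => [A0|_]; last by rewrite dom0.
by rewrite domU1 /= h.
Qed.

(** Chains supported here are the error terms: the computations in links below hold modulo them. *)
Definition low m : pred simplex := fun s => (sing (sshape s) < m)%N.

(** A face that omits a vertex outside the last factor has fewer singular vertices. *)
Lemma boundary_low s (A : vfamily (sshape s)) :
  all (low (\sum_(i < n.+1 | i != ord_max) #|A i|)%N) (dom (chain_boundary (sub_chain R A)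
    - \sum_(v in A ord_max) (-1) ^+ (\sum_(i < n.+1 | i != ord_max) #|A i|
        + #|[set u in A ord_max | (u < v)%N]|)%N *: sub_chain R (remove A v))).
Proof.
rewrite boundary_sub_chain [X in X - _](bigD1 ord_max) //=.
have -> : (\sum_(i < n.+1 | (i < n)%N) #|A i|
    = \sum_(i < n.+1 | i != ord_max) #|A i|)%N.
  by apply: eq_bigl => i; rewrite ltn_neqAle -ltnS ltn_ord andbT.
rewrite addrAC subrr add0r; apply: supp_sum => l lm; apply: supp_sum => v vA.
apply: supp_scale; apply: supp_sub_chain => A0; rewrite /low /= sing_sub.
rewrite (bigD1 l) //= [X in (_ < X)%N](bigD1 l) //= remove_in (cardsD1 v (A l)) vA add1n addSn ltnS.
rewrite leq_add2l leq_sum // => i /andP[_ il]; rewrite remove_out // eq_sym //.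
Qed.

Lemma sub_chain_incl s t (f : face_incl s t) (A : vfamily (sshape s)) :
  sub_chain R A = sub_chain R (image_family f A).
Proof.
have H a b (g : join_mor a b) (x : K b) (y : K a) (B : vfamily a) : restr K g x = y ->
    @sub_chain _ _ R (mk_simplex y) B = @sub_chain _ _ R (mk_simplex x) (image_family g B).
  by move<-; exact: (@sub_chain_restr _ _ R _ (mk_simplex x)).
by case: s t f A => [a s] [b t] [f fP] A; exact: H.
Qed.

Section Fiber.
Variable s : simplex.
Hypothesis rs : ~~ regular (sshape s).
Local Notation m := (sing (sshape s)).

Definition link_family (x : coface s) (S : {set 'I_(sshape x ord_max)}) : vfamily (sshape x) :=
  dfwith (image_family (coface_incl x) (@full_family _ (sshape s))) S.
Arguments link_family : clear implicits.

(* s * S, for a set S of vertices of the last factor of the coface x. *)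
Definition link_chain (x : coface s) S : chains := sub_chain R (link_family x S).
Arguments link_chain : clear implicits.

Lemma link_in x S : link_family x S ord_max = S.
Proof. exact: dfwith_in. Qed.

Lemma link_out x S i : i != ord_max -> link_family x S i = coface_incl x i @: setT.
Proof. by move=> im; rewrite /link_family dfwith_out // eq_sym. Qed.

Lemma sum_link x S : (\sum_(i < n.+1 | i != ord_max) #|link_family x S i| = m)%N.
Proof.
apply: eq_bigr => i im; rewrite link_out // -[RHS](card_full (sshape s)).
exact: card_image_family.
Qed.

Lemma full_max0 i (v : 'I_(sshape s i)) : i != ord_max.
Proof.
apply/eqP => e; subst i; case/negP: rs.
exact: leq_ltn_trans (ltn_ord v).
Qed.

Lemma link_set0 x : link_chain x set0 = << s >>.
Proof.
rewrite -[RHS](sub_chain_full R) (sub_chain_incl (coface_incl x)); congr (sub_chain R _).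
apply: vfamilyP => i; have [->|im] := eqVneq i ord_max; last by rewrite link_out.
rewrite link_in; apply/esym/setP => v; rewrite inE.
by apply/imsetP => -[y] _ _; have := full_max0 y; rewrite eqxx.
Qed.

Lemma remove_link (x : coface s) (S : {set 'I_(sshape x ord_max)}) v :
  remove (link_family x S) v = link_family x (S :\ v).
Proof.
apply: vfamilyP => i; have [<-|im] := eqVneq ord_max i; first by rewrite remove_in !link_in.
by rewrite remove_out // !link_out // eq_sym.
Qed.

(** Modulo [low], the boundary of s * S is, up to the sign (-1)^m, the join of s with the augmented
    boundary of S: chains of the link can be computed with through s. *)
Lemma boundary_link (x : coface s) (S : {set 'I_(sshape x ord_max)}) :
  all (low m) (dom (chain_boundary (link_chain x S)
  - \sum_(v in S) (-1) ^+ (m + #|[set u in S | (u < v)%N]|) *: link_chain x (S :\ v))).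
Proof.
have := boundary_low (link_family x S); rewrite sum_link link_in.
by under eq_bigr do rewrite remove_link.
Qed.

Lemma supp_link (x : coface s) (S : {set 'I_(sshape x ord_max)}) :
  all (fun t => (sing (sshape t) == m) && (sshape t ord_max == #|S|))
  (dom (link_chain x S)).
Proof.
by apply: supp_sub_chain => A0; rewrite /= sing_sub sum_link ffunE link_in !eqxx.
Qed.

(* c - e is, up to simplices with fewer singular vertices, the boundary of s * p with p a
   1-chain of the link of s. *)
Definition joined (c e : chains) := exists p : chains,
  all (fun t => (sing (sshape t) == m) && (sshape t ord_max == 2)) (dom p) /\
  all (low m) (dom (chain_boundary p - (c - e))).

Lemma joined_refl c : joined c c.
Proof. by exists 0; rewrite linear0 !subrr dom0. Qed.

Lemma joined_sym c e : joined c e -> joined e c.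
Proof.
move=> [p [p1 p2]]; exists (- p); split; first exact: supp_opp.
rewrite linearN (_ : _ - _ = - (chain_boundary p - (c - e))) ?supp_opp //.
by rewrite !opprB addrC.
Qed.

Lemma joined_trans c d e : joined c d -> joined d e -> joined c e.
Proof.
move=> [p [p1 p2]] [q [q1 q2]]; exists (p + q); split; first exact: supp_add.
rewrite (_ : _ - _ = (chain_boundary p - (c - d)) + (chain_boundary q - (d - e))); first exact: supp_add p2 q2.
by rewrite linearD addrACA -opprD addrA subrK.
Qed.

Lemma joined_edge (x : coface s) (u v : 'I_(sshape x ord_max)) :
  joined (link_chain x [set u]) (link_chain x [set v]).
Proof.
have H (a b : 'I_(sshape x ord_max)) : (a < b)%N ->
    joined (link_chain x [set b]) (link_chain x [set a]).
  move=> ab; have nab : a != b by apply: contraTneq ab => ->; rewrite ltnn.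
  (* The factor cancels the sign due to the m vertices of s preceding the edge. *)
  exists ((-1) ^+ m *: link_chain x [set a; b]); split.
    by apply: supp_scale; have := supp_link [set a; b]; rewrite cards2 nab.
  have := supp_scale ((-1) ^+ m) (boundary_link [set a; b]).
  rewrite linearZ scalerBr big_setU1 ?inE //= big_set1.
  rewrite (_ : [set u in [set a; b] | (u < a)%N] = set0); last first.
    apply/setP => z; rewrite !inE; apply/negP => /andP[/orP[]/eqP->]; first by rewrite ltnn.
    by rewrite ltnNge ltnW.
  rewrite (_ : [set u in [set a; b] | (u < b)%N] = [set a]); last first.
    apply/setP => z; rewrite !inE; have [->|za] /= := eqVneq z a; first exact: ab.
    by apply/negP => /andP[/eqP->]; rewrite ltnn.
  rewrite cards0 cards1 setU1K ?inE // (_ : [set a; b] :\ b = [set a]); last first.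
    by rewrite setUC setU1K // inE eq_sym.
  rewrite addn0 addn1 exprS mulN1r scaleNr scalerDr scalerN !scalerA -exprD addnn.
  by rewrite -mul2n exprM sqrrN !expr1n !scale1r.
have [uv|uv|/val_inj->] := ltngtP u v; last exact: joined_refl.
  exact/joined_sym/H.
exact: H.
Qed.

Lemma link_le (x y : coface s) (v : 'I_(sshape x ord_max)) : coface_le x y ->
  exists w, link_chain x [set v] = link_chain y [set w].
Proof.
move=> [f fE]; exists (f ord_max v); rewrite /link_chain (sub_chain_incl f); congr (sub_chain R _).
apply: vfamilyP => i; have [->|im] := eqVneq i ord_max.
  by rewrite /image_family !link_in imset_set1.
by rewrite /image_family !link_out // -fE -imset_comp.
Qed.

(** The link of s is connected: two vertices in the last factor of one coface span an edge, and the
    zigzag leads from one coface to the next. *)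
Lemma joined_cofaces (hK : normal_face_set K) (x y : coface s)
  (v : 'I_(sshape x ord_max)) (w : 'I_(sshape y ord_max)) :
  joined (link_chain x [set v]) (link_chain y [set w]).
Proof.
have le (a b : coface s) (v' : 'I_(sshape a ord_max)) (w' : 'I_(sshape b ord_max)) : coface_le a b ->
    joined (link_chain a [set v']) (link_chain b [set w']).
  by move=> /(link_le v')[u ->]; exact: joined_edge.
have [k [z [z0 zk zle]]] := proj2 hK s rs x y.
have h i : (i <= k.+1)%N -> forall u : 'I_(sshape (z i.*2) ord_max),
  joined (link_chain x [set v]) (link_chain (z i.*2) [set u]).
  elim: i => [_|i IH ik u]; first by rewrite /= z0 => u; exact: joined_edge.
  have [le1 le2] := zle i ik.
  pose v1 := Ordinal (coface_regular (z i.*2)); pose v2 := Ordinal (coface_regular (z i.*2.+1)).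
  apply: joined_trans (IH (ltnW ik) v1) _; apply: joined_trans (le _ _ v1 v2 le1) _.
  exact/joined_sym/le.
by move: (h k.+1 (leqnn _)); rewrite doubleS zk; apply.
Qed.

End Fiber.

End Links.
Arguments admissible {n K} s.

(** * Retraction onto GM-chains *)

Section Homotopy.
Variables (R : idomainType) (n : nat) (K : filtered_face_set n).
Local Notation simplex := (simplex K).
Local Notation chains := {freeg simplex / R}.
Hypothesis hK : normal_face_set K.
Implicit Types (s t u : simplex) (c : chains).

(** For singular s, p is (-1)^m times s * v0, with m the number of vertices of s and v0 a vertex of
    its link; the sign makes the boundary equal to s modulo [low]. The last clause provides paths to
    v0. Putting the hypothesis under the existential makes the choice total in s. *)
Lemma cone_chain_exists s : exists p : chains, ~~ regular (sshape s) ->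
  [/\ all (fun t => (sing (sshape t) == sing (sshape s)) && (sshape t ord_max == 1%N)) (dom p),
      all (low (sing (sshape s))) (dom (chain_boundary p - << s >>)) &
      forall (y : coface s) w,
        joined s (link_chain R (x := y) [set w]) ((-1) ^+ sing (sshape s) *: p)].
Proof.
have [rs|rs] := boolP (regular (sshape s)); first by exists 0.
have [x _] := coface_exists hK s; pose v := Ordinal (coface_regular x).
exists ((-1) ^+ sing (sshape s) *: link_chain R (x := x) [set v]) => _; split.
- by apply: supp_scale; have := supp_link R (x := x) [set v]; rewrite cards1.
- have := supp_scale ((-1) ^+ sing (sshape s)) (boundary_link R (x := x) [set v]).
  rewrite linearZ scalerBr big_set1 setDv (link_set0 R rs) (_ : [set u in _ | _] = set0).
    by rewrite cards0 addn0 scalerA -exprD addnn -mul2n exprM sqrrN !expr1n scale1r.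
  by apply/setP => u; rewrite !inE; apply/negP => /andP[/eqP->]; rewrite ltnn.
move=> y w; rewrite scalerA -exprD addnn -mul2n exprM sqrrN !expr1n scale1r.
exact: joined_cofaces.
Qed.

Definition cone_chain s : chains := projT1 (cid (cone_chain_exists s)).

Lemma cone_chainP s : ~~ regular (sshape s) ->
  [/\ all (fun t => (sing (sshape t) == sing (sshape s)) && (sshape t ord_max == 1%N))
        (dom (cone_chain s)),
      all (low (sing (sshape s))) (dom (chain_boundary (cone_chain s) - << s >>)) &
      forall (y : coface s) w,
        joined s (link_chain R (x := y) [set w]) ((-1) ^+ sing (sshape s) *: cone_chain s)].
Proof. exact: projT2 (cid (cone_chain_exists s)). Qed.

(** Such an s has exactly one vertex v in the last factor, so s = t * v with t singular; p is the
    join of t with a path between v and the vertex chosen in the link of t. *)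
Lemma path_exists s : ~~ admissible s -> regular (sshape s) -> exists (p : chains) t,
  [/\ ~~ regular (sshape t), sing (sshape t) = sing (sshape s),
      all (fun u => (sing (sshape u) == sing (sshape s)) && (sshape u ord_max == 2)) (dom p),
      all (low (sing (sshape s))) (dom (chain_boundary p
        - (<< s >> - (-1) ^+ sing (sshape s) *: cone_chain t))) &
      all (low (sing (sshape s)))
        (dom (chain_boundary (<< s >> : chains) - (-1) ^+ sing (sshape s) *: << t >>))].
Proof.
rewrite /admissible negb_or -leqNgt => /andP[s0 s1] rs.
pose B : vfamily (sshape s) := dfwith (@full_family _ (sshape s)) (set0 : {set 'I_(sshape s ord_max)}).
have Bin : B ord_max = set0 by exact: dfwith_in.
have Bout i : i != ord_max -> B i = setT by move=> im; rewrite /B dfwith_out // eq_sym.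
have Bsing : (\sum_(i < n.+1 | i != ord_max) #|B i| = sing (sshape s))%N.
  by apply: eq_bigr => i im; rewrite Bout // cardsT card_ord.
have B0 : (0 < \sum_i #|B i|)%N.
  by rewrite (bigD1 ord_max) //= Bsing ltn_addl // lt0n.
pose t := sub_simplex B0.
have tsing : sing (sshape t) = sing (sshape s) by rewrite /t /= sing_sub.
have rt : ~~ regular (sshape t) by rewrite /regular /t /= ffunE Bin cards0.
pose y : coface t := @Coface _ _ t s rs (@FaceIncl _ _ t s (sub_mor B0) erefl).
pose v : 'I_(sshape y ord_max) := Ordinal rs.
have vE (w : 'I_(sshape y ord_max)) : w = v.
  by apply: val_inj => /=; have := ltn_ord w; rewrite /= in s1 *; lia.
have linkE : link_chain R (x := y) [set v] = << s >>.
  rewrite -[RHS](sub_chain_full R); congr (sub_chain R _); apply: vfamilyP => i.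
  have [->|im] := eqVneq i ord_max.
    by rewrite link_in; apply/setP => w; rewrite !inE (vE w) eqxx.
  rewrite link_out //; apply: etrans (Bout i im).
  exact: (congr1 (fun C : vfamily (sshape s) => C i) (image_sub_mor B0)).
have [_ _ /(_ y v) [p [p1 p2]]] := cone_chainP rt.
exists p, t; rewrite tsing linkE in p1 p2; split=> //.
have := boundary_link R (x := y) [set v]; rewrite linkE big_set1 setDv (link_set0 R rt).
rewrite (_ : [set u in _ | _] = set0) ?cards0 ?addn0 ?tsing //.
by apply/setP => u; rewrite !inE; apply/negP => /andP[/eqP->]; rewrite ltnn.
Qed.

Lemma contraction_exists s : exists p : chains,
  [/\ all (fun t => (sing (sshape t) == sing (sshape s)) && (sdim t == (sdim s).+1)) (dom p),
      admissible s -> p = 0,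
      ~~ regular (sshape s) -> p = cone_chain s &
      ~~ admissible s -> regular (sshape s) -> all admissible (dom p) /\
        exists t, [/\ ~~ regular (sshape t), sing (sshape t) = sing (sshape s),
          all (low (sing (sshape s))) (dom (chain_boundary p
            - (<< s >> - (-1) ^+ sing (sshape s) *: cone_chain t))) &
          all (low (sing (sshape s))) (dom (chain_boundary (<< s >> : chains)
            - (-1) ^+ sing (sshape s) *: << t >>))]].
Proof.
have sE := sdim_sing s.
have [rs|rs] := boolP (regular (sshape s)); last first.
  have [p1 _ _] := cone_chainP rs; exists (cone_chain s); split=> //.
    apply: suppW p1 => t /andP[/eqP tE /eqP t1]; rewrite tE eqxx /=; have := sdim_sing t.
    by move: rs; rewrite /regular -leqNgt leqn0 => /eqP rs; lia.
  by move: rs; rewrite /regular /admissible -leqNgt leqn0 => /eqP rs; rewrite rs in sE * => /orP[/eqP|//]; lia.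
have [as_|as_] := boolP (admissible s).
  by exists 0; split=> //; rewrite dom0.
have [p [t [t1 t2 p1 p2 p3]]] := path_exists as_ rs; exists p; split=> //.
  apply: suppW p1 => u /andP[/eqP uE /eqP u1]; rewrite uE eqxx /=; have := sdim_sing u.
  move: as_ rs; rewrite /admissible /regular negb_or -leqNgt => /andP[_ s1] s0; lia.
move=> _ _; split; last by exists t.
by apply: suppW p1 => u /andP[_ /eqP u1]; rewrite /admissible u1 orbT.
Qed.

Definition contraction0 s : chains := projT1 (cid (contraction_exists s)).

Definition contraction : {linear chains -> chains} := free_lift contraction0.

Definition bdry : {linear chains -> chains} :=
  mk_linear (fun a x y => linearP (@chain_boundary R n K) a x y).

Definition improve : {linear chains -> chains} :=
  (idfun \- (contraction \o bdry)) \- (bdry \o contraction).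

Lemma improveE c : improve c = c - contraction (bdry c) - bdry (contraction c).
Proof. by []. Qed.

Lemma bdry2 c : bdry (bdry c) = 0.
Proof. exact: chain_boundary_boundary. Qed.

Lemma improve_bdry c : bdry (improve c) = improve (bdry c).
Proof. by rewrite !improveE !linearB !bdry2 subr0 linear0 subr0. Qed.

Lemma contraction0P s :
  [/\ all (fun t => (sing (sshape t) == sing (sshape s)) && (sdim t == (sdim s).+1))
        (dom (contraction << s >>)),
      admissible s -> contraction << s >> = 0,
      ~~ regular (sshape s) -> contraction << s >> = cone_chain s &
      ~~ admissible s -> regular (sshape s) -> all admissible (dom (contraction << s >>)) /\
        exists t, [/\ ~~ regular (sshape t), sing (sshape t) = sing (sshape s),
          all (low (sing (sshape s))) (dom (bdry (contraction << s >>)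
            - (<< s >> - (-1) ^+ sing (sshape s) *: cone_chain t))) &
          all (low (sing (sshape s))) (dom (bdry << s >> - (-1) ^+ sing (sshape s) *: << t >>))]].
Proof. by rewrite free_liftU; exact: projT2 (cid (contraction_exists s)). Qed.

Lemma contraction_low m c : all (low m) (dom c) -> all (low m) (dom (contraction c)).
Proof.
apply: supp_lin => s sm; have [h _ _ _] := contraction0P s.
by apply: suppW h => t /andP[/eqP tE _]; rewrite /low tE.
Qed.

Lemma contraction_admissible c : all admissible (dom c) -> contraction c = 0.
Proof.
move=> /allP h; apply: free_lift_eq0 => s /h sa.
by have [_ /(_ sa) <- _ _] := contraction0P s; rewrite free_liftU.
Qed.

Lemma bdry_faces s : all (fun t => (sing (sshape t) <= sing (sshape s))%N
    && (sshape s ord_max <= (sshape t ord_max).+1)%N) (dom (bdry << s >>)).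
Proof.
rewrite /= boundary_full; apply: supp_sum => l _; apply: supp_sum => v _; apply: supp_scale.
apply: supp_sub_chain => A0; rewrite /= sing_sub ffunE.
have E i : (#|remove (@full_family _ (sshape s)) v i| <= sshape s i
    <= #|remove (@full_family _ (sshape s)) v i|.+1)%N.
  have [li|li] := eqVneq l i; last by rewrite remove_out // card_full leqnn leqnSn.
  subst i; rewrite remove_in -[in X in (_ <= X <= _)%N](card_full (sshape s) l).
  by rewrite (cardsD1 v (full_family _ l)) in_setT add1n leqnSn leqnn.
have E1 i := proj1 (andP (E i)); have E2 i := proj2 (andP (E i)).
by rewrite E2 andbT; apply: leq_sum => i _; exact: E1.
Qed.

(** The filtration along which the iterates of [improve] descend; for m = 0 it reduces to
    admissibility. *)
Definition nearly_admissible m : pred simplex :=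
  fun s => admissible s || (sing (sshape s) <= m)%N.

Lemma nearly_low m m' : (m <= m'.+1)%N -> subpred (low (K := K) m) (nearly_admissible m').
Proof. by move=> mm s sm; rewrite /nearly_admissible -ltnS (leq_trans sm mm) orbT. Qed.

(** [contraction] kills s. An inadmissible face of s can only occur when s has two vertices in the
    last factor; the face is then regular, and its contraction is an admissible path chain. *)
Lemma improve_admissible s : admissible s -> all admissible (dom (improve << s >>)).
Proof.
move=> sa; have s1 : all admissible (dom (<< s >> : chains)) by rewrite domU1 /= sa.
rewrite improveE (contraction_admissible s1) linear0 subr0; apply: supp_sub; first by rewrite domU1 /= sa.
have := bdry_faces s; apply: supp_lin => t /andP[ts st].
have [ta|ta] := boolP (admissible t).
  by rewrite (contraction_admissible (c := << t >>)) ?domU1 /= ?ta // dom0.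
have [_ _ _ []//] := contraction0P t.
move: sa ta; rewrite /admissible /regular negb_or => /orP[/eqP s0|s2] /andP[t0 _]; last by lia.
by move: t0; rewrite -leqn0 -s0 ts.
Qed.

(** For s = t * v, modulo [low], dh(s) is s minus a signed [cone_chain t] and hd(s) is that same
    term, so everything cancels. For singular s, dh(s) is s modulo [low], and all faces of s already
    have fewer singular vertices. *)
Lemma improve_nearly m c :
  all (nearly_admissible m) (dom c) -> all (nearly_admissible m.-1) (dom (improve c)).
Proof.
apply: supp_lin => s; have [sa _|sa] := boolP (admissible s).
  by apply: suppW (improve_admissible sa) => t; rewrite /nearly_admissible => ->.
case/orP=> [|sm]; first by rewrite (negPf sa).
apply: (suppW (P := low (sing (sshape s)))).
  apply: nearly_low; move: sm; case: m => //=.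
  by rewrite leqn0 => s0; move: sa; rewrite /admissible s0.
have [_ _ ncone /(_ sa) path] := contraction0P s.
have [rs|rs] := boolP (regular (sshape s)).
  have [_ [t [rt tE p1 p2]]] := path rs.
  have := supp_opp (supp_add p1 (contraction_low p2)).
  have [_ _ /(_ rt) ct _] := contraction0P t.
  have cancel (V : zmodType) (x y z e : V) : z - y - x = - (x - (z - e) + (y - e)).
    by rewrite opprD !opprB (addrAC z (- e)) subrKA addrAC.
  have -> : contraction (bdry << s >> - (-1) ^+ sing (sshape s) *: << t >>) =
      contraction (bdry << s >>) - (-1) ^+ sing (sshape s) *: cone_chain t.
    by rewrite linearB linearZ -ct.
  by rewrite improveE -cancel.
have [p1 p2 _] := cone_chainP rs.
rewrite improveE ncone // addrAC; apply: supp_sub.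
  by rewrite -opprB supp_opp.
apply: contraction_low; apply: suppW (dim_boundary R s) => t /eqP tE.
have := sdim_sing s; have := sdim_sing t; move: rs; rewrite /low /regular -leqNgt leqn0 => /eqP rs.
by lia.
Qed.

Lemma improve_dim k c :
  all (fun s => sdim s == k) (dom c) -> all (fun s => sdim s == k) (dom (improve c)).
Proof.
apply: supp_lin => s /eqP sk; rewrite improveE.
have h t : all (fun u => sdim u == (sdim t).+1) (dom (contraction << t >>)).
  by have [h _ _ _] := contraction0P t; apply: suppW h => u /andP[].
apply: supp_sub; first (apply: supp_sub; first by rewrite domU1 /= sk eqxx).
  by have := dim_boundary R s; rewrite sk; apply: supp_lin => t /eqP <-.
by rewrite -sk; apply: dom_chain_boundary.
Qed.

Lemma improve_fixed c : all admissible (dom c) -> all admissible (dom (bdry c)) -> improve c = c.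
Proof. by move=> h1 h2; rewrite improveE !contraction_admissible // subr0 linear0 subr0. Qed.

Definition improves N : {linear chains -> chains} :=
  mk_linear (fun a x y => (fix lin N := if N is N'.+1 return iter N improve (a *: x + y) =
    a *: iter N improve x + iter N improve y then
    etrans (congr1 improve (lin N')) (linearP improve a _ _) else erefl) N).

Lemma improves_bdry N c : bdry (improves N c) = improves N (bdry c).
Proof. by elim: N => //= N IH; rewrite -[LHS]/(bdry (improve _)) improve_bdry -IH. Qed.

Lemma improves_dim N k c :
  all (fun s => sdim s == k) (dom c) -> all (fun s => sdim s == k) (dom (improves N c)).
Proof. by move=> ck; elim: N => //= N; exact: improve_dim. Qed.

Lemma improves_fixed N c : all admissible (dom c) -> all admissible (dom (bdry c)) ->
  improves N c = c.
Proof.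
move=> h1 h2; elim: N => [//|N IH]; rewrite -[LHS]/(improve (improves N c)) IH.
exact: improve_fixed.
Qed.

(** A simplex of dimension below N has at most N singular vertices, and each iteration lowers this
    bound by one on the inadmissible simplices. *)
Lemma improves_admissible N c : all (fun s => sdim s < N)%N (dom c) ->
  all admissible (dom (improves N c)).
Proof.
move=> cN; apply: (suppW (P := nearly_admissible (N - N))).
  by move=> s; rewrite subnn /nearly_admissible leqn0 /admissible => /orP[|->].
have h M : all (nearly_admissible (N - M)) (dom (improves M c)).
  elim: M => [|M IH]; last by rewrite subnS; exact: improve_nearly.
  rewrite subn0; apply: suppW cN => s sN; have := sdim_sing s.
  by rewrite /nearly_admissible => sE; apply/orP; right; lia.
exact: h.
Qed.

Lemma improves_homotopy N : exists H : {linear chains -> chains},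
  (forall k c, all (fun s => sdim s == k) (dom c) -> all (fun s => sdim s == k.+1) (dom (H c))) /\
  forall c, c = improves N c + bdry (H c) + H (bdry c).
Proof.
elim: N => [|N [H [Hd HE]]].
  by exists (\0 : {linear chains -> chains}); split=> [k c _|c] /=; rewrite ?dom0 ?linear0 ?addr0.
(* The homotopies h composed with the successive iterates telescope. *)
pose H' : {linear chains -> chains} := H \+ (contraction \o improves N).
have H'E c : H' c = H c + contraction (improves N c) by [].
exists H'; split=> [k c ck|c].
  rewrite H'E; apply: supp_add; first exact: Hd.
  have := improves_dim N ck; apply: supp_lin => s /eqP <-.
  by have [h _ _ _] := contraction0P s; apply: suppW h => u /andP[].
have alg (V : zmodType) (x y z p q : V) : x + p + q = x - y - z + (p + z) + (q + y).
  by rewrite [p + z]addrC (addrA (x - y - z)) subrK [q + y]addrC [x - y + p]addrAC subrKA.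
rewrite !H'E -[improves N.+1 c]/(improve (improves N c)) improveE linearD -improves_bdry.
by rewrite -alg.
Qed.

End Homotopy.

(** * Restriction of simplicial cochains to GM-chains *)

Section GMIso.
Variables (R : idomainType) (n : nat) (K : filtered_face_set n).
Local Notation simplex := (simplex K).
Local Notation chains := {freeg simplex / R}.
Local Notation full_chain := (supported_chain R (@predT simplex)).
Local Notation gm_chain := (supported_chain R (gm_admissible (K := K) tprime_perversity)).
Local Notation cochains := (dual_complex (simplicial_chain_complex R K)).
Local Notation gm_cochains := (dual_complex (gm_chain_complex R K tprime_perversity)).

Lemma full_chainP k (c : chains) : all (fun s => sdim s == k) (dom c) ->
  c \in spred (Submodule (@supported_closed R n K predT k)).
Proof. by move=> ck; apply/and3P; split; rewrite ?all_predT. Qed.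

Lemma gm_chainP k (c : chains) : all (fun s => sdim s == k) (dom c) ->
  all admissible (dom c) -> all admissible (dom (chain_boundary c)) ->
  c \in spred (Submodule (@supported_closed R n K (gm_admissible tprime_perversity) k)).
Proof. by move=> ck c1 c2; apply/and3P; rewrite gm_admissibleE. Qed.

Lemma gm_chain_dim k (c : gm_chain k) : all (fun s => sdim s == k) (dom (val c)).
Proof. by have /and3P[] := submodP c. Qed.

Lemma gm_chain_admissible k (c : gm_chain k) : all admissible (dom (val c)).
Proof. by rewrite -gm_admissibleE; have /and3P[] := submodP c. Qed.

Lemma gm_bdry_admissible k (c : gm_chain k) : all admissible (dom (chain_boundary (val c))).
Proof. by rewrite -gm_admissibleE; have /and3P[] := submodP c. Qed.

Lemma full_chain_dim k (c : full_chain k) : all (fun s => sdim s == k) (dom (val c)).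
Proof. by have /and3P[] := submodP c. Qed.

Definition forget_map k (c : gm_chain k) : full_chain k := Submod (full_chainP (gm_chain_dim c)).

Lemma forget_linear k : linear (@forget_map k).
Proof. by move=> a x y; apply: val_inj. Qed.

Definition forget k : {linear gm_chain k -> full_chain k} := mk_linear (@forget_linear k).

Definition restriction_map k (f : {linear full_chain k -> R^o}) : {linear gm_chain k -> R^o} :=
  f \o forget k.

Lemma restriction_linear k : linear (@restriction_map k).
Proof. by move=> a f g; apply: hom_eqP. Qed.

Definition restriction k : {linear cochains k -> gm_cochains k} := mk_linear (@restriction_linear k).

Lemma restriction_d k (f : cochains k) :
  restriction k.+1 (coboundary cochains k f) = coboundary gm_cochains k (restriction k f).
Proof. by apply: hom_eqP => c /=; congr (f _); apply: val_inj. Qed.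

Hypothesis hK : normal_face_set K.
Local Notation improves := (improves R hK).

Section Retraction.
Variables (N k : nat) (kN : (k < N)%N).

Lemma retraction_subproof (c : full_chain k) : improves N (val c)
  \in spred (Submodule (@supported_closed R n K (gm_admissible tprime_perversity) k)).
Proof.
have ck := full_chain_dim c; apply: gm_chainP; first exact: improves_dim.
  by apply: improves_admissible; apply: suppW ck => s /eqP->.
rewrite -[chain_boundary _]/(bdry R K _) improves_bdry; apply: improves_admissible.
move: ck; apply: supp_lin => s /eqP sk; apply: suppW (dim_boundary R s) => t /eqP tE.
by apply: leq_trans (ltnW kN); rewrite -sk -tE.
Qed.

(** In degree k any N > k gives admissible chains; [retraction_boundary] uses a common N for two
    consecutive degrees. *)
Definition retraction_map (c : full_chain k) : gm_chain k := Submod (retraction_subproof c).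

Lemma retraction_linear : linear retraction_map.
Proof. by move=> a x y; apply: val_inj; rewrite -[LHS]/(improves N _) !linearP. Qed.

Definition retraction : {linear full_chain k -> gm_chain k} := mk_linear retraction_linear.

Lemma retraction_forget c : retraction (forget k c) = c.
Proof.
apply: val_inj; apply: improves_fixed; [exact: gm_chain_admissible|exact: gm_bdry_admissible].
Qed.

End Retraction.

Lemma retraction_boundary N k (kN : (k < N)%N) (kN' : (k.+1 < N)%N) (c : full_chain k.+1) :
  retraction kN (boundary (simplicial_chain_complex R K) k c)
  = boundary (gm_chain_complex R K tprime_perversity) k (retraction kN' c).
Proof. by apply: val_inj; exact/esym/improves_bdry. Qed.

Lemma H_simp_GM k : lmod_iso (H_simp R K k) (H_GM R tprime_perversity K k).
Proof.
apply: (@quasi_iso_lmod_iso _ _ _ restriction).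
- exact: restriction_d.
- move=> f fd.
  have fb c : free_lift (values f) (bdry R K c) = 0.
    transitivity (free_lift (values (coboundary cochains k f)) c).
      by apply: (eq_free (f := free_lift (values f) \o bdry R K)) => s _; rewrite free_liftU values_coboundary.
    by rewrite fd free_lift_eq0.
  have [H [Hd HE]] := improves_homotopy R hK k.+1.
  (* The homotopy formula is evaluated on the cocycle f, which kills the term dH. *)
  have fE (c : full_chain k) : f c = f (forget k (retraction (leqnn k.+1) c))
      + free_lift (values f) (H (bdry R K (val c))).
    by rewrite !values_liftE {1}(HE (val c)) !linearD fb addr0.
  (* In degree 0 a coboundary is zero by definition, and the correction term vanishes because
     vertices have zero boundary. *)
  case: k f fd fb H Hd HE fE => [|k] f fd fb H Hd HE fE.
    move=> f0; apply: hom_eqP => c; rewrite fE.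
    have -> : bdry R K (val c) = 0.
      apply: (etrans (eq_free (f := bdry R K) (g := \0) _)) => // s /(allP (full_chain_dim c)) s0.
      by rewrite /= chain_boundaryU simplex_boundary0 //; move: s0; rewrite /sdim /join_dim; lia.
    rewrite !linear0 addr0.
    exact: (congr1 (fun g : gm_cochains 0 => g _) f0).
  move=> [g gE].
  have HP (c : full_chain k) : H (val c) \in spred (Submodule (@supported_closed R n K predT k.+1)).
    exact/full_chainP/Hd/full_chain_dim.
  (* The cochain bounding f: g pulled back along the retraction, corrected by f composed with H. *)
  have yl : linear (fun c : full_chain k => g (retraction (leqnSn k.+1) c)
       + free_lift (values f) (H (val c)) : R^o).
    by move=> a x y; rewrite !linearP /= scalerDr addrACA.
  exists (mk_linear yl); apply: hom_eqP => c; rewrite fE; congr (_ + _).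
  have := congr1 (fun h : gm_cochains k.+1 => h (retraction (leqnn k.+2) c)) gE.
  by rewrite /= => ->; rewrite -(retraction_boundary (leqnSn k.+1)).
(* For surjectivity, g is precomposed with the retraction, which restricts to g itself. Here N = k +
   2, so that the retraction also exists in degree k + 1 and f is a cocycle. *)
move=> g gd; pose f : {linear full_chain k -> R^o} :=
  (g : {linear gm_chain k -> R^o}) \o retraction (leqnSn k.+1).
exists f.
  apply: hom_eqP => c.
  apply: etrans (congr1 (g : gm_chain k -> R^o) (retraction_boundary (leqnSn k.+1) (leqnn k.+2) c)) _.
  exact: (congr1 (fun h : gm_cochains k.+1 => h _) gd).
rewrite (_ : _ - g = 0); first exact: is_coboundary0.
apply/eqP; rewrite subr_eq0; apply/eqP; apply: hom_eqP => c.
exact: (congr1 (g : gm_chain k -> R^o) (retraction_forget (leqnSn k.+1) c)).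
Qed.

End GMIso.

Theorem proposition1p57 (R : idomainType) (hR : principal_ideal_domain R)
    (n : nat) (K : filtered_face_set n) (hK : normal_face_set K) :
  forall k : nat,
    lmod_iso (H_TW R zero_perversity K k) (H_GM R tprime_perversity K k) /\
    lmod_iso (H_GM R tprime_perversity K k) (H_simp R K k).
Proof.
move=> k; have GM := H_simp_GM R hK k.
split; last exact: lmod_iso_sym.
exact: lmod_iso_trans (lmod_iso_sym (H_simp_TW R hK k)) GM.
Qed.
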